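(* There is an absolute constant $C_0>0$ such that for every $n\in\mathbb N$ and every non-commutative polynomial $\mathfrak p\in\mathbb C\langle x_1,\dots,x_n\rangle$ of degree two there are constants $C=C(\mathfrak p)>0$ and $c=c(\mathfrak p)>0$ depending only on $\mathfrak p$ such that the following holds. Let $N\in\mathbb N$, let $X_1,\dots,X_n$ be $n$ independent $N\times N$ complex Ginibre matrices and set $P=\mathfrak p(X_1,\dots,X_n)$. For any $z\in\mathbb C$ and any $\varepsilon>0$, $$\mathbb P\big\{\sigma_{\min}(P-z)\le\varepsilon\big\}\le C\big(N^{C_0}\varepsilon^{c}+e^{-N}\big).$$
   Context: $\mathbb C\langle x_1,\dots,x_n\rangle$ is the set of polynomials with complex coefficients in $n$ non-commuting indeterminates. An $N\times N$ complex Ginibre matrix $X$ is a random matrix such that $(\sqrt N\,\Re X_{i,j})_{i,j}$ and $(\sqrt N\,\Im X_{i,j})_{i,j}$ are independent families of i.i.d. $\mathcal N(0,1/2)$ variables. $\sigma_{\min}$ denotes the smallest singular value of a square matrix, and $P-z$ means $P-z\,\mathrm I_N$. *)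

(* Defs.v *)
From HB Require Import structures.
(* The notations of monalg and of MathComp-Analysis have incompatible levels. *)
From mathcomp.multinomials Require Import -(notations) monalg.
From mathcomp Require Import all_boot all_order all_algebra.
From mathcomp Require Import finmap.
From mathcomp Require Import all_classical all_reals all_analysis.
From mathcomp Require Import complex.

Set Implicit Arguments.
Unset Strict Implicit.
Unset Printing Implicit Defensive.

Import Order.TTheory GRing.Theory Num.Theory.

Local Open Scope classical_set_scope.
Local Open Scope ring_scope.
Local Open Scope complex_scope.

(* Non-commutative polynomials: the monoid algebra of the free monoid. *)
Definition ncpoly (K : nzRingType) (n : nat) := malg (fmonom 'I_n) K.

(* [mmeasure fdeg p] is 1 + the maximal length of a word of p (0 for p = 0). *)
Definition ncdeg (K : nzRingType) (n : nat) (p : ncpoly K n) : nat :=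
  (mmeasure (@fdeg 'I_n) p).-1.

Definition nceval (K : comNzRingType) (n N : nat) (p : ncpoly K n)
    (A : 'I_n -> 'M[K]_N) : 'M[K]_N :=
  \sum_(w <- msupp p) mcoeff w p *: \prod_(i <- fmonom_val w) A i.

Definition singular_value (R : realType) (N : nat) (A : 'M[R[i]]_N) (s : R) :
    Prop :=
  0 <= s /\ eigenvalue (map_mx Num.conj A^T *m A) ((s ^+ 2)%:C).

(* For 0 < N the set of singular values is finite and nonempty, so that its
   infimum is attained. *)
Definition sigma_min (R : realType) (N : nat) (A : 'M[R[i]]_N) : R :=
  inf [set s | singular_value A s].

Section independence.
Context (R : realType) (d : measure_display) (T : measurableType d).
Variable P : probability T R.

Definition mutual_independence (I : choiceType) (F : I -> set_system T) : Prop :=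
  (forall i, F i `<=` measurable) /\
  forall (J : {fset I}) (E : I -> set T), (forall i, i \in J -> F i (E i)) ->
    P (\bigcap_(i in [set` J]) E i) = (\prod_(i <- J) P (E i))%E.

Definition sigma_generated (J : Type) (f : J -> T -> R) : set_system T :=
  <<s \bigcup_(j in [set: J]) preimage_set_system [set: T] (f j) measurable >>.

(* The families [f i], not their individual members, are independent. *)
Definition independent_families (I : choiceType) (J : Type)
    (f : I -> J -> T -> R) : Prop :=
  mutual_independence (fun i => sigma_generated (f i)).

Definition independent_RVs (I : choiceType) (f : I -> T -> R) : Prop :=
  independent_families (fun i (_ : unit) => f i).

(* [s] is the standard deviation, as in [normal_prob]. *)
Definition iid_normal (I : choiceType) (f : I -> T -> R) (m s : R) : Prop :=
  [/\ forall i, measurable_fun [set: T] (f i),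
      independent_RVs f
    & forall i (B : set R), measurable B ->
        pushforward P (f i) B = normal_prob m s B].

Definition entry_Re (N : nat) (X : T -> 'M[R[i]]_N) (ij : 'I_N * 'I_N) (t : T) :
    R := complex.Re (X t ij.1 ij.2).

Definition entry_Im (N : nat) (X : T -> 'M[R[i]]_N) (ij : 'I_N * 'I_N) (t : T) :
    R := complex.Im (X t ij.1 ij.2).

Definition entry_parts (N : nat) (X : T -> 'M[R[i]]_N)
    (bij : bool * ('I_N * 'I_N)) : T -> R :=
  if bij.1 then entry_Re X bij.2 else entry_Im X bij.2.

Definition complex_ginibre (N : nat) (X : T -> 'M[R[i]]_N) : Prop :=
  let re ij t := Num.sqrt N%:R * entry_Re X ij t in
  let im ij t := Num.sqrt N%:R * entry_Im X ij t in
  [/\ iid_normal re 0 (Num.sqrt (1 / 2)),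
      iid_normal im 0 (Num.sqrt (1 / 2))
    & independent_families (fun b : bool => if b then re else im)].

Definition independent_matrices (n N : nat) (X : 'I_n -> T -> 'M[R[i]]_N) :
    Prop :=
  independent_families (fun k => entry_parts (X k)).

End independence.

(* Main.v *)
(* Write [P = \sum a_ij X_i X_j + \sum b_i X_i + c], let [G] be the inverse of
   [P - z], [T_m = \sum_j a_mj X_j + b_m] and [S_m = \sum_i a_im X_i].  The
   determinant [f] of [P - z] is a polynomial of degree at most two in each real
   coordinate, and so is each of its partial derivatives; for a quadratic
   polynomial [q] of a Gaussian variable, [|q'/q| <= 1/e] outside a set of
   probability [O(e)].  Applied twice, this bounds all first and second
   logarithmic derivatives of [f], i.e. the matrices [T_m G + G S_m] and certain
   second-order expressions in [G].
   If [a] has rank at least two and [G] has a huge entry, the second-order bounds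
   make the corresponding normalised row of [G] an approximate common left
   eigenvector of all the [S_m].  Two of the [S_m] are linearly independent
   combinations of Gaussian matrices, and for a fixed vector this costs
   [4 (N - 1)] real coordinates, which beats the entropy of a net of the
   vectors; hence the term [e^(-N)].
   If [a] has rank one, [a_ij = u_i v_j], the first-order bounds suffice: either
   a combination of them isolates [G], or a linear form times [G], or [P - z] is
   a product of two linear forms.
   Exceptional zeros of [f] are avoided by perturbing [z] generically. *)

Require Import Defs.
From HB Require Import structures.
From mathcomp.multinomials Require Import -(notations) monalg.
From mathcomp Require Import all_boot all_order all_algebra.
From mathcomp Require Import finmap.
From mathcomp Require Import all_classical all_reals all_analysis.
From mathcomp Require Import complex perm.
From mathcomp Require Import measurable_realfun.
From mathcomp Require Import ring lra.

Import Order.TTheory GRing.Theory Num.Theory.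
Import numFieldTopology.Exports.

Local Open Scope classical_set_scope.
Local Open Scope ring_scope.
Local Open Scope complex_scope.

Set Implicit Arguments.
Unset Strict Implicit.
Unset Printing Implicit Defensive.

(** * Resampling one coordinate of a product law *)

(** A single [S_m] always has a left eigenvector, so one matrix alone excludes nothing: in a net of
    mesh [1/K] each free complex entry of the vector costs a factor of order [K^2], and the matching
    complex coordinate gains only [K^-2]. Two independent [S_m] gain [K^-4]; this is why rank one is
    a separate regime. When the rank is at least two, the first-order bounds alone are hard to use
    because [T_m G] mixes all rows of [G]. Variations inside column [i] of [X_m] see [T_m G] only
    through its row [i], which equals [d - g S_m] with [d] the bounded row of first derivatives and
    [g] row [i] of [G]; the second-order bounds thus become relations on the single row [g]. All
    estimates are uniform in the constant term of the polynomial, which carries both [z] and the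
    generic perturbation. The exponents arise as follows: outside probability of order
    [N^4 e + e^(-N)] the entries of [G] are [O(N^10 / e^2)], which excludes singular values below a
    multiple of [e^2 / N^12]; solving for [e] gives [N^10] and the square root of [eps]. *)

Section arrays.
Context (R : realType) (J : finType).

(* [J -> R] carries no product sigma-algebra in the library. *)
Definition box (B : J -> set R) : set (J -> R) := [set w | forall j, B j (w j)].

Definition boxes : set (set (J -> R)) :=
  [set A | exists2 B : J -> set R, (forall j, measurable (B j)) & A = box B].

Definition array := g_sigma_algebraType boxes.
HB.instance Definition _ := Pointed.copy array (g_sigma_algebraType boxes).
HB.instance Definition _ := Measurable.copy array (g_sigma_algebraType boxes).

Definition upd (w : array) (r : J) (s : R) : array :=
  fun j => if j == r then s else w j.

Lemma updE w r s : upd w r s r = s. Proof. by rewrite /upd eqxx. Qed.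

Lemma upd_neq w r s j : j != r -> upd w r s j = w j.
Proof. by rewrite /upd => /negbTE ->. Qed.

Lemma upd_id w r : upd w r (w r) = w.
Proof. by apply/funext => j; rewrite /upd; case: eqP => // ->. Qed.

Lemma upd_upd w r s s' : upd (upd w r s) r s' = upd w r s'.
Proof. by apply/funext => j; rewrite /upd; case: eqP. Qed.

Lemma updC w r r' s s' : r != r' ->
  upd (upd w r s) r' s' = upd (upd w r' s') r s.
Proof.
move=> rr'; apply/funext => j; rewrite /upd.
by case: (eqVneq j r') => [->|]; rewrite // eq_sym (negbTE rr').
Qed.

Lemma measurable_box (B : J -> set R) :
  (forall j, measurable (B j)) -> measurable (box B : set array).
Proof. by move=> mB; apply: sub_sigma_algebra; exists B. Qed.

Lemma measurable_coord j : measurable_fun [set: array] (fun w : array => w j).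
Proof.
move=> _ B mB; rewrite setTI.
have -> : (fun w : array => w j) @^-1` B =
    box (fun i => if i == j then B else setT).
  apply/seteqP; split => w /=; rewrite /box/=.
    by move=> Bw i; case: eqP => // ->.
  by move=> /(_ j); rewrite eqxx.
by apply: measurable_box => i; case: ifP.
Qed.

Lemma measurable_arrayP d (T : measurableType d) (f : T -> array) :
  (forall j, measurable_fun [set: T] (fun t => f t j)) ->
  measurable_fun [set: T] f.
Proof.
move=> mf; have mE : @measurable _ array = <<s (boxes : set (set array)) >> by [].
refine (@measurability _ _ T array setT f boxes mE _).
move=> _ [_ [B mB ->] <-]; rewrite setTI.
have -> : f @^-1` box B = \bigcap_(j in [set: J]) ((fun t => f t j) @^-1` B j).
  by apply/seteqP; split => [t /= + j _|t /= + j]; [exact|move=> /(_ j); exact].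
apply: fin_bigcap_measurable => // j _.
by rewrite -[X in measurable X]setTI; exact: mf.
Qed.

Lemma measurable_upd (r : J) :
  measurable_fun [set: array * R] (fun ws => upd ws.1 r ws.2).
Proof.
apply: measurable_arrayP => j; rewrite /upd.
case: (j == r); first exact: measurable_snd.
exact: (measurableT_comp (measurable_coord j) measurable_fst).
Qed.

Lemma measurable_upd_fix (w : array) (r : J) :
  measurable_fun [set: R] (fun s => upd w r s).
Proof.
apply: measurable_arrayP => j; rewrite /upd.
case: (j == r); first exact: measurable_id.
exact: measurable_cst.
Qed.

Lemma setI_closed_boxes : setI_closed boxes.
Proof.
move=> _ _ [A mA ->] [B mB ->].
exists (fun j => A j `&` B j); first by move=> j; exact: measurableI.
apply/seteqP; split => w /=.
  by move=> [Aw Bw] j; split; [exact: Aw|exact: Bw].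
by move=> ABw; split => j; [exact: (ABw j).1|exact: (ABw j).2].
Qed.

Variables (gam : probability R R) (mu : probability array R).

Definition product_law := forall B : J -> set R, (forall j, measurable (B j)) ->
  mu (box B) = (\prod_j gam (B j))%E.

Hypothesis mu_prod : product_law.

(** [mu] is the image of the product of [mu] and [gam] under [upd]: the two agree on boxes, which
    are stable under intersection and generate. *)
Lemma resample (r : J) (E : set array) : measurable E ->
  mu E = (\int[mu]_w gam [set s | E (upd w r s)])%E.
Proof.
move=> mE.
pose f : array * R -> array := fun ws => upd ws.1 r ws.2.
have mf : measurable_fun setT f by exact: measurable_upd.
pose F : {mfun (array * R)%type >-> array} := mfun_Sub (mem_set mf).
pose nu := pushforward (mu \x gam)%E F.
have nuE : mu E = nu E.
  have key := (@measure_unique _ R array boxes (fun=> setT) (erefl _) _ _ _ mu nu _ _ E mE).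
  apply: key => //.
  - exact: setI_closed_boxes.
  - move=> _; exists (fun=> setT) => //.
    by apply/seteqP; split.
  - by apply/seteqP; split => // x _; exists 0%N.
  - move=> _ [B mB ->]; rewrite [LHS](mu_prod mB).
    transitivity ((mu \x gam)%E (box (fun j => if j == r then setT else B j) `*` B r)); last first.
      congr ((mu \x gam)%E _); apply/seteqP; split => -[w s] /=; rewrite /box /f /=.
        move=> [Bw Bs] j; rewrite /upd; have := Bw j.
        by case: eqP => // ->.
      move=> Bw; split; last by have := Bw r; rewrite updE.
      by move=> j; case: eqVneq => // jr; have := Bw j; rewrite upd_neq.
    have mB' j : measurable (if j == r then setT else B j) by case: ifP.
    rewrite product_measure1E//; last exact: measurable_box.
    rewrite [X in _ = (X * _)%E](mu_prod mB').
    rewrite (bigD1 r)//= [in RHS](bigD1 r)//= eqxx.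
    have gT : gam ([set: R] : set R) = 1%E by exact: probability_setT.
    rewrite gT mul1e muleC.
    by congr (_ * _)%E; apply: eq_bigr => j /negbTE ->.
  - move=> _; apply: (@le_lt_trans _ _ 1%E); last exact: ltry.
    exact: probability_le1.
rewrite nuE /nu /pushforward /product_measure1 /=.
apply: eq_integral => w _ /=; congr (gam _).
by apply/seteqP; split => s /=; rewrite /xsection/= inE.
Qed.

(** [E] forces [A] whatever value coordinate [r] takes, so the inner probability is at most [q]
    times the indicator of [A]. The full set [A] serves for one coordinate; a smaller [A] lets such
    bounds be multiplied by induction. *)
Lemma resample_le (r : J) (E A : set array) (q : R) :
  0 <= q -> measurable E -> measurable A ->
  (forall w s, E (upd w r s) -> A w) ->
  (forall w, (gam [set s | E (upd w r s)] <= q%:E)%E) ->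
  (mu E <= q%:E * mu A)%E.
Proof.
move=> q0 mE mA EA Eq; rewrite (resample r mE).
have msec w : measurable [set s | E (upd w r s)].
  have := measurable_upd_fix w r.
  by move=> /(_ measurableT _ mE); rewrite setTI.
apply: (@le_trans _ _ (\int[mu]_w (q%:E * (\1_A w)%:E))%E).
  apply: ge0_le_integral => //.
  - rewrite [X in measurable_fun _ X](_ : _ =
        gam \o xsection ((fun ws => upd ws.1 r ws.2) @^-1` E)).
      apply: measurable_fun_xsection; rewrite -[X in measurable X]setTI.
      exact: (measurable_upd r measurableT mE).
    apply/funext => w /=; congr (gam _).
    by apply/seteqP; split => s /=; rewrite /xsection/= inE.
  - by apply/measurable_EFinP; apply: measurable_funM => //; exact: measurable_indic.
  - move=> w _; rewrite indicE; case: (boolP (w \in A)) => wA; first by rewrite mule1.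
    rewrite mule0 (_ : [set s | _] = set0) ?measure0//.
    apply/seteqP; split => // s /= /EA; move: wA; rewrite notin_setE; tauto.
rewrite ge0_integralZl//=; first by rewrite integral_indic ?setIT.
by apply/measurable_EFinP; exact: measurable_indic.
Qed.

(** A bound on the outer measure. The events below quantify over vectors and matrix entries, and in
    this form they can be included and united without a measurability proof for each. *)
Definition small (E : set array) (q : R) :=
  exists2 F : set array, measurable F /\ E `<=` F & (mu F <= q%:E)%E.

Lemma small_sub E F q : E `<=` F -> small F q -> small E q.
Proof. by move=> EF [G [mG FG] Gq]; exists G => //; split=> // x /EF/FG. Qed.

Lemma small_le E q q' : q <= q' -> small E q -> small E q'.
Proof.
by move=> qq' [G G' Gq]; exists G => //; rewrite (le_trans Gq)// lee_fin.
Qed.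

Lemma small_measurable E q : measurable E -> (mu E <= q%:E)%E -> small E q.
Proof. by move=> mE Eq; exists E => //; split. Qed.

Lemma measurable_small E q : measurable E -> small E q -> (mu E <= q%:E)%E.
Proof.
move=> mE [F [mF EF] Fq]; apply: le_trans Fq.
by apply: le_measure => //; exact: mem_set.
Qed.

Lemma small0 q : 0 <= q -> small set0 q.
Proof. by move=> q0; exists set0; [split|rewrite measure0 lee_fin]. Qed.

Lemma smallU E F q q' : small E q -> small F q' -> small (E `|` F) (q + q').
Proof.
move=> [E' [mE EE'] Eq] [F' [mF FF'] Fq]; exists (E' `|` F').
  by split; [exact: measurableU|exact: setUSS].
rewrite EFinD (le_trans (measureU2 _ _ _))//.
exact: leeD.
Qed.

Lemma small_bigU_seq (I : Type) (s : seq I) (P : pred I) (E : I -> set array) (q : I -> R) :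
  (forall i, P i -> small (E i) (q i)) ->
  small (\big[setU/set0]_(i <- s | P i) E i) (\sum_(i <- s | P i) q i).
Proof.
move=> sE; elim/big_ind2: _ => //; first exact: small0.
by move=> *; exact: smallU.
Qed.

Lemma small_exists (I : finType) (E : I -> set array) (q : R) :
  (forall i, small (E i) q) ->
  small [set w | exists i, E i w] (#|I|%:R * q).
Proof.
move=> sE; rewrite (_ : _ * q = \sum_(i : I) q); last first.
  by rewrite sumr_const mulr_natl.
apply: small_sub (@small_bigU_seq _ (index_enum I) xpredT E _ (fun i _ => sE i)).
by move=> w [i Eiw]; rewrite -bigcup_seq; exists i => //=; exact: mem_index_enum.
Qed.

End arrays.

(** * Determinants of quadratic matrix polynomials *)

Section determinants.
Context (F : fieldType).

(** Both sides are the determinant of the block matrix with rows [1, U] and [-V, 1], factored in two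
    ways. *)
Lemma det1D_mulC (m n : nat) (U : 'M[F]_(m, n)) (V : 'M[F]_(n, m)) :
  \det (1%:M + U *m V) = \det (1%:M + V *m U).
Proof.
have E1 : block_mx 1%:M U (- V) 1%:M =
    block_mx 1%:M 0 (- V) 1%:M *m block_mx 1%:M U 0 (1%:M + V *m U).
  rewrite mulmx_block !mul1mx !mulmx1 !mul0mx !addr0.
  by rewrite addrC mulNmx addrK.
have E2 : block_mx 1%:M U (- V) 1%:M =
    block_mx (1%:M + U *m V) U 0 1%:M *m block_mx 1%:M 0 (- V) 1%:M.
  rewrite mulmx_block !mul1mx !mulmx1 !mul0mx !mulmx0 !add0r mulmxN.
  by rewrite addrK.
have := congr1 determinant E1; rewrite {1}E2 !det_mulmx.
by rewrite !det_lblock !det_ublock !det1 !mul1r !mulr1.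
Qed.

Lemma det_block11 (a b c d : F) :
  \det (block_mx a%:M b%:M c%:M d%:M : 'M[F]_(1 + 1)) = a * d - b * c.
Proof.
rewrite (expand_det_row _ ord0) !big_ord_recl big_ord0.
rewrite /cofactor !det_mx11 !mxE.
do ![case: splitP => [[[|?] ?]|[[|?] ?]] //= _; rewrite ?mxE //=].
by rewrite /bump /= addn0 add0n expr0 expr1; ring.
Qed.

(** Once [M] is factored out, [det1D_mulC] trades the [N]-dimensional determinant for a 2x2 one. *)
Lemma det_addr_rank2 (N : nat) (M : 'M[F]_N) (u1 u2 : 'cV_N) (r1 r2 : 'rV_N) :
  M \in unitmx ->
  \det (M + u1 *m r1 + u2 *m r2) = \det M *
    ((1 + (r1 *m invmx M *m u1) 0 0) * (1 + (r2 *m invmx M *m u2) 0 0)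
     - (r1 *m invmx M *m u2) 0 0 * (r2 *m invmx M *m u1) 0 0).
Proof.
move=> uM; set G := invmx M.
have -> : M + u1 *m r1 + u2 *m r2 =
    M *m (1%:M + row_mx (G *m u1) (G *m u2) *m col_mx r1 r2).
  rewrite mul_row_col mulmxDr mulmx1 mulmxDr !mulmxA mulmxV// !mul1mx addrA //.
rewrite det_mulmx det1D_mulC; congr (_ * _).
rewrite mul_col_row -!mulmxA (mx11_scalar (r1 *m _)) (mx11_scalar (r1 *m (G *m u2))).
rewrite (mx11_scalar (r2 *m _)) (mx11_scalar (r2 *m (G *m u2))).
rewrite scalar_mx_block add_block_mx !add0r.
have s11 (x : F) : (x%:M : 'M[F]_1) 0 0 = x by rewrite mxE eqxx.
by rewrite !s11 -!raddfD /= det_block11 !mulmxA.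
Qed.

End determinants.

Section quadratic.
Context (F : fieldType) (n N : nat).
Variables (a : 'I_n -> 'I_n -> F) (b : 'I_n -> F) (c : F).
Implicit Types X : 'I_n -> 'M[F]_N.

Definition quadmx X : 'M[F]_N :=
  \sum_i \sum_j a i j *: (X i *m X j) + \sum_i b i *: X i + c%:M.

(** The [T_m] and [S_m] of the overview: [D *m qleft X m + qright X m *m D] is the derivative of
    [quadmx] when [X m] moves in the direction [D]. *)
Definition qleft X (m : 'I_n) : 'M[F]_N := \sum_j a m j *: X j + (b m)%:M.
Definition qright X (m : 'I_n) : 'M[F]_N := \sum_i a i m *: X i.

Definition shift_mx X (m : 'I_n) (D : 'M[F]_N) : 'I_n -> 'M[F]_N :=
  fun k => X k + (k == m)%:R *: D.

Lemma sum_delta (V : lmodType F) (m : 'I_n) (G : 'I_n -> V) :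
  \sum_k (k == m)%:R *: G k = G m.
Proof.
rewrite (bigD1 m)//= eqxx scale1r big1 ?addr0// => k /negbTE ->.
by rewrite scale0r.
Qed.

Lemma quadmx_shift X m D : quadmx (shift_mx X m D) =
  quadmx X + D *m qleft X m + qright X m *m D + a m m *: (D *m D).
Proof.
rewrite /quadmx /shift_mx.
have -> : \sum_i \sum_j a i j *: ((X i + (i == m)%:R *: D) *m (X j + (j == m)%:R *: D))
  = \sum_i \sum_j a i j *: (X i *m X j)
   + \sum_i (i == m)%:R *: \sum_j a i j *: (D *m X j)
   + \sum_j (j == m)%:R *: \sum_i a i j *: (X i *m D)
   + \sum_i (i == m)%:R *: \sum_j (j == m)%:R *: (a i j *: (D *m D)).
  have -> : \sum_j (j == m)%:R *: (\sum_i a i j *: (X i *m D)) =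
      \sum_i \sum_j (j == m)%:R *: (a i j *: (X i *m D)).
    by rewrite exchange_big; apply: eq_bigr => j _; rewrite scaler_sumr.
  rewrite -!big_split /=.
  apply: eq_bigr => i _; rewrite !scaler_sumr -!big_split /=.
  apply: eq_bigr => j _.
  rewrite mulmxDl !mulmxDr -!scalemxAl -!scalemxAr !scalerDr !scalerA.
  rewrite !addrA [a i j * (i == m)%:R]mulrC [a i j * (j == m)%:R]mulrC.
  by rewrite [_ * a i j * _]mulrAC; congr (_ + _); rewrite addrAC.
have -> : \sum_i b i *: (X i + (i == m)%:R *: D) = \sum_i b i *: X i + b m *: D.
  rewrite -[b m *: D](sum_delta m (fun k => b k *: D)) -big_split /=.
  by apply: eq_bigr => i _; rewrite scalerDr !scalerA [b i * _]mulrC.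
rewrite !sum_delta /qleft /qright mulmxDr mulmx_sumr mulmx_suml mul_mx_scalar.
have -> : \sum_i D *m (a m i *: X i) = \sum_j a m j *: (D *m X j).
  by apply: eq_bigr => j _; rewrite scalemxAr.
have -> : \sum_i (a i m *: X i) *m D = \sum_i a i m *: (X i *m D).
  by apply: eq_bigr => j _; rewrite scalemxAl.
by rewrite [LHS](AC (4*2*1) (1*5*7*(2*6)*3*4)).
Qed.


(** A change of column [i] is the rank-one matrix [D = h *m delta_mx 0 i], and [D *m D] is [h i 0]
    times [D]. All terms of [quadmx_shift] therefore form an update of rank at most two, and the
    determinant has degree at most two in [h]. *)
Lemma det_quadmx_col X m i (h : 'cV[F]_N) :
  let M := quadmx X in let G := invmx M in
  let g0 := row i G in let g1 := row i (qleft X m *m G) in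
  let S := qright X m in
  M \in unitmx ->
  \det (quadmx (shift_mx X m (h *m delta_mx 0 i))) = \det M *
    (1 + (g1 *m h) 0 0 + (g0 *m S *m h) 0 0 + a m m * h i 0 * (g0 *m h) 0 0
     + (g1 *m h) 0 0 * (g0 *m S *m h) 0 0
     - (g0 *m h) 0 0 * (g1 *m S *m h) 0 0).
Proof.
move=> M G g0 g1 S uM.
pose r1 := delta_mx 0 i *m qleft X m + (a m m * h i 0) *: delta_mx 0 i : 'rV_N.
have -> : quadmx (shift_mx X m (h *m delta_mx 0 i)) =
    M + h *m r1 + (S *m h) *m delta_mx 0 i.
  rewrite quadmx_shift -/M -/S /r1 mulmxDr -scalemxAr !mulmxA.
  rewrite [LHS](AC (4) (1*(2*4)*3)) /=; congr (_ + (_ + _) + _).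
  have -> : h *m delta_mx 0 i *m h = (h i 0) *: h.
    rewrite -mulmxA (mx11_scalar (_ *m h)) mul_mx_scalar.
    by rewrite -rowE mxE.
  by rewrite -scalemxAl scalerA.
rewrite det_addr_rank2 // -/G; congr (_ * _).
have g0E : delta_mx 0 i *m G = g0 by rewrite /g0 rowE.
have g1E : delta_mx 0 i *m qleft X m *m G = g1 by rewrite /g1 rowE mulmxA.
rewrite /r1 mulmxDl g1E -scalemxAl g0E !mulmxA !mulmxDl -!scalemxAl.
rewrite !(mxE _ _ 0 0); ring.
Qed.

(* Row [i] of [qleft X m *m G + G *m qright X m] collects the first-order
   variations of [ln det] along column [i] of [X m]; [hess] collects the
   second-order variations of [det]. *)
Definition grad X m : 'M[F]_N :=
  qleft X m *m invmx (quadmx X) + invmx (quadmx X) *m qright X m.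

Definition hess X m (i j k : 'I_N) : F :=
  let g := row i (invmx (quadmx X)) in let d := row i (grad X m) in
  let S := qright X m in
  a m m * ((i == j)%:R * g 0 k + (i == k)%:R * g 0 j)
  + (d 0 j * (g *m S) 0 k + d 0 k * (g *m S) 0 j)
  - (g 0 j * (d *m S) 0 k + g 0 k * (d *m S) 0 j)
  - 2 * ((g *m S) 0 j * (g *m S) 0 k)
  + (g 0 j * (g *m S *m S) 0 k + g 0 k * (g *m S *m S) 0 j).

Lemma det_quadmx_col2 X m i (j k : 'I_N) (s t : F) :
  quadmx X \in unitmx -> (2 : F) != 0 ->
  \det (quadmx (shift_mx X m ((s *: delta_mx j 0 + t *: delta_mx k 0 : 'cV_N) *m delta_mx 0 i))) =
  \det (quadmx X) * (1 + s * grad X m i j + t * grad X m i k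
    + s ^+ 2 / 2 * hess X m i j j + s * t * hess X m i j k
    + t ^+ 2 / 2 * hess X m i k k).
Proof.
move=> uM two0; rewrite det_quadmx_col //=; congr (_ * _).
set G := invmx _; set S := qright X m; set g0 := row i G; set g1 := row i _.
have vE (v : 'rV[F]_N) : (v *m (s *: delta_mx j 0 + t *: delta_mx k 0 : 'cV_N)) 0 0 =
    s * v 0 j + t * v 0 k.
  by rewrite mulmxDr -!scalemxAr -!colE !mxE.
rewrite !vE /hess -/G -/S -/g0.
(* [hess] is stated with row [i] of [grad] instead of [g1], because [grad] is the quantity that gets
   bounded and [g1] still contains [qleft]. *)
have -> : row i (grad X m) = g1 + g0 *m S by rewrite linearD /= -/G -/S [row i (G *m S)]row_mul.
have gE l : grad X m i l = g1 0 l + (g0 *m S) 0 l.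
  by rewrite /grad -/G -/S /g1 /g0 -row_mul !(mxE _ _ 0 l) mxE.
have addE (u v : 'rV[F]_N) l : (u + v) 0 l = u 0 l + v 0 l by rewrite mxE.
have -> : (s *: delta_mx j 0 + t *: delta_mx k 0 : 'cV_N) i 0 =
    s * (i == j)%:R + t * (i == k)%:R.
  by rewrite !mxE !andbT.
rewrite !gE mulmxDl !addE.
by field.
Qed.

End quadratic.

(** * Logarithmic derivatives along Gaussian coordinates *)

Notation normc := ComplexField.Normc.normc.

Section gauss.
Context (R : realType).

(* [normal_prob] is a probability on [measurableTypeR R] rather than on [R]. *)
Definition gauss (A : set R) : \bar R := normal_prob (0 : R) (Num.sqrt (1 / 2)) A.

Let normal : probability (measurableTypeR R) R :=
  normal_prob (0 : R) (Num.sqrt (1 / 2)).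

Let gauss0 : gauss set0 = 0%E. Proof. exact: (measure0 normal). Qed.

Let gauss_ge0 A : (0 <= gauss A)%E. Proof. exact: (measure_ge0 normal). Qed.

Let gauss_sigma_additive : semi_sigma_additive gauss.
Proof. exact: (@measure_semi_sigma_additive _ _ _ normal). Qed.

HB.instance Definition _ := isMeasure.Build _ R R gauss
  gauss0 gauss_ge0 gauss_sigma_additive.

Let gauss_setT : gauss [set: R] = 1%E.
Proof. exact: (probability_setT normal). Qed.

HB.instance Definition _ := Measure_isProbability.Build _ R R gauss gauss_setT.

Let sd : R := Num.sqrt (1 / 2).

Let sd_neq0 : sd != 0. Proof. by rewrite gt_eqF// sqrtr_gt0. Qed.

Let measurable_pdf (s : R) : measurable_fun [set: measurableTypeR R]
  (fun x => (normal_pdf 0 s x)%:E).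
Proof. by have /integrableP[] := integrable_normal_pdf (0 : R) s. Qed.

Lemma gauss_pdf_le1 (x : R) : normal_pdf 0 sd x <= 1.
Proof.
rewrite (le_trans (normal_pdf_ub _ _ sd_neq0))// /normal_peak.
rewrite sqr_sqrtr// mulr2n -mulrDr -mulr2n invf_le1.
  by rewrite -[leLHS]sqrtr1 ler_sqrt// -mulr_natl; have := pi_ge2 R; nra.
by rewrite sqrtr_gt0 -mulr_natl; have := pi_gt0 R; nra.
Qed.

Lemma gauss_interval (c e : R) : 0 <= e ->
  (gauss [set s | (`|s - c| <= e)%R] <= (2 * e)%:E)%E.
Proof.
move=> e0.
have -> : [set s | `|s - c| <= e] = `[c - e, c + e]%classic.
  by apply/seteqP; split => s /=; rewrite in_itv /= ler_distl.
rewrite /gauss /= /normal_prob.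
apply: (@le_trans _ _ (\int[lebesgue_measure]_(x in `[(c - e)%R, (c + e)%R]) (cst 1%E x)))%E.
  apply: ge0_le_integral => //=.
  - by move=> x _; rewrite lee_fin normal_pdf_ge0.
  - refine (measurable_funTS (measurable_pdf sd)).
  - by move=> x _; rewrite lee_fin gauss_pdf_le1.
rewrite integral_cst//= mul1e lebesgue_measure_itv /= lte_fin.
case: ltP => _; last by rewrite lee_fin mulr_ge0.
by rewrite -EFinD lee_fin; lra.
Qed.

(** Where [t < |x|], the density [exp(-x^2) / sqrt pi] is at most [2 exp(-t^2/2)] times the standard
    normal density, whose total mass is one. *)
Lemma gauss_tail (t : R) : 0 <= t ->
  (gauss [set s | (t < `|s|)%R] <= (2 * expR (- (t ^+ 2 / 2)))%:E)%E.
Proof.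
move=> t0; rewrite /gauss /= /normal_prob -/sd.
have mt : measurable [set s : R | t < `|s|].
  rewrite [X in measurable X](_ : _ = ~` `[- t, t]%classic); last first.
    by apply/seteqP; split => s /=; rewrite in_itv /= -ler_norml ltNge => /negP.
  exact: measurableC.
set A := [set s | _]; set K := 2 * _; have K0 : 0 <= K by rewrite mulr_ge0 ?expR_ge0.
apply: (@le_trans _ _ (K%:E * normal_prob (0 : R) 1 A)%E); last first.
  rewrite -[leRHS]mule1 lee_wpmul2l ?lee_fin//.
  exact: (@probability_le1 _ _ _ (normal_prob (0 : R) 1 : probability (measurableTypeR R) R)).
rewrite /normal_prob -ge0_integralZl//=.
- apply: ge0_le_integral => //=.
  + by move=> x _; rewrite lee_fin normal_pdf_ge0.
  + refine (measurable_funTS (measurable_pdf sd)).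
  + refine (measurable_funTS _); apply: emeasurable_funM => //.
  + move=> x /= tx; rewrite lee_fin !normal_pdfE ?oner_eq0//.
    rewrite /normal_peak /normal_fun.
    rewrite sqr_sqrtr// expr1n subr0 mul1r.
    rewrite mul1r; have -> : (2^-1 : R) * pi *+ 2 = pi by rewrite -mulr_natl; lra.
    have -> : (2^-1 : R) *+ 2 = 1 by rewrite -mulr_natl; lra.
    rewrite -[pi *+ 2]mulr_natl sqrtrM// invfM.
    have s2 : Num.sqrt 2 <= 2 :> R.
      by rewrite -[leRHS]ger0_norm// -sqrtr_sqr ler_sqrt; nra.
    have s20 : 0 < Num.sqrt 2 :> R by rewrite sqrtr_gt0.
    have p0 : 0 < Num.sqrt pi :> R by rewrite sqrtr_gt0 pi_gt0.
    rewrite /K [leRHS](_ : _ = (2 / Num.sqrt 2) *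
        ((Num.sqrt pi)^-1 * (expR (- (t ^+ 2 / 2)) * expR (- x ^+ 2 / 2)))).
      rewrite -[leLHS]mul1r ler_pM ?divr_ge0 ?mulr_ge0 ?invr_ge0 ?expR_ge0 ?(ltW s20) ?(ltW p0)//.
        by rewrite ler_pdivlMr// mul1r.
      rewrite ler_pM2l ?invr_gt0// -expRD ler_expR divr1.
      have : t ^+ 2 <= x ^+ 2.
        by rewrite -[x ^+ 2]real_normK ?num_real// lerXn2r ?nnegrE// ltW.
      lra.
    by field; rewrite !gt_eqF.
- refine (measurable_funTS (measurable_pdf 1)).
- by move=> x _; rewrite lee_fin normal_pdf_ge0.
Qed.

End gauss.

(** * Measurability of complex functions, matrices and determinants *)

Section complex_measurability.
Context (R : realType) d (T : measurableType d).
Implicit Types f g : T -> R[i].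

Definition cmeas f := measurable_fun [set: T] (fun t => complex.Re (f t)) /\
  measurable_fun [set: T] (fun t => complex.Im (f t)).

Lemma cmeas_ext f g : f =1 g -> cmeas f -> cmeas g.
Proof. by move=> /funext ->. Qed.

Lemma cmeas_cst (z : R[i]) : cmeas (fun=> z).
Proof. by split; exact: measurable_cst. Qed.

Lemma cmeasD f g : cmeas f -> cmeas g -> cmeas (fun t => f t + g t).
Proof.
move=> [fr fi] [gr gi]; split.
  rewrite (_ : (fun _ => _) = (fun t => complex.Re (f t) + complex.Re (g t))).
    exact: measurable_funD.
  by apply/funext => t; case: (f t) (g t) => [? ?] [].
rewrite (_ : (fun _ => _) = (fun t => complex.Im (f t) + complex.Im (g t))).
  exact: measurable_funD.
by apply/funext => t; case: (f t) (g t) => [? ?] [].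
Qed.

Lemma cmeasM f g : cmeas f -> cmeas g -> cmeas (fun t => f t * g t).
Proof.
move=> [fr fi] [gr gi]; split.
  rewrite (_ : (fun _ => _) = (fun t => complex.Re (f t) * complex.Re (g t)
      - complex.Im (f t) * complex.Im (g t))).
    by apply: measurable_funB; exact: measurable_funM.
  by apply/funext => t; case: (f t) (g t) => [? ?] [].
rewrite (_ : (fun _ => _) = (fun t => complex.Re (f t) * complex.Im (g t)
      + complex.Im (f t) * complex.Re (g t))).
  by apply: measurable_funD; exact: measurable_funM.
by apply/funext => t; case: (f t) (g t) => [? ?] [].
Qed.

Lemma cmeasN f : cmeas f -> cmeas (fun t => - f t).
Proof.
move=> mf; apply: cmeas_ext (cmeasM (cmeas_cst (-1)) mf) => t.
by rewrite mulN1r.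
Qed.

Lemma cmeasB f g : cmeas f -> cmeas g -> cmeas (fun t => f t - g t).
Proof. by move=> mf mg; exact: cmeasD mf (cmeasN mg). Qed.

Lemma cmeas_conj f : cmeas f -> cmeas (fun t => (f t)^*).
Proof.
move=> [fr fi]; split.
  by rewrite (_ : (fun _ => _) = (fun t => complex.Re (f t)))//; apply/funext => t; case: (f t).
rewrite (_ : (fun _ => _) = (fun t => - complex.Im (f t))).
  exact: measurable_funN.
by apply/funext => t; case: (f t).
Qed.

Lemma cmeas_sum (I : Type) (s : seq I) (P : pred I) (F : I -> T -> R[i]) :
  (forall i, cmeas (F i)) -> cmeas (fun t => \sum_(i <- s | P i) F i t).
Proof.
move=> mF; elim: s => [|i s IH].
  by apply: cmeas_ext (cmeas_cst 0) => t; rewrite big_nil.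
case Pi : (P i); last first.
  by apply: cmeas_ext IH => t; rewrite big_cons Pi.
by apply: cmeas_ext (cmeasD (mF i) IH) => t; rewrite big_cons Pi.
Qed.

Lemma cmeas_prod (I : Type) (s : seq I) (P : pred I) (F : I -> T -> R[i]) :
  (forall i, cmeas (F i)) -> cmeas (fun t => \prod_(i <- s | P i) F i t).
Proof.
move=> mF; elim: s => [|i s IH].
  by apply: cmeas_ext (cmeas_cst 1) => t; rewrite big_nil.
case Pi : (P i); last first.
  by apply: cmeas_ext IH => t; rewrite big_cons Pi.
by apply: cmeas_ext (cmeasM (mF i) IH) => t; rewrite big_cons Pi.
Qed.

Lemma cmeas_normc f : cmeas f -> measurable_fun [set: T] (fun t => normc (f t)).
Proof.
move=> [fr fi].
rewrite (_ : (fun _ => _) = (fun t =>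
    Num.sqrt (complex.Re (f t) ^+ 2 + complex.Im (f t) ^+ 2))); last first.
  by apply/funext => t; case: (f t).
apply: (@measurableT_comp _ _ _ _ _ _ (@Num.sqrt R)).
  exact: (continuous_measurable_fun (@sqrt_continuous R)).
by apply: measurable_funD; exact: measurable_funX.
Qed.

Definition mmeas (p q : nat) (A : T -> 'M[R[i]]_(p, q)) :=
  forall i j, cmeas (fun t => A t i j).

Lemma mmeas_cst p q (A : 'M[R[i]]_(p, q)) : mmeas (fun=> A).
Proof. by move=> i j; exact: cmeas_cst. Qed.

Lemma mmeasD p q (A B : T -> 'M[R[i]]_(p, q)) :
  mmeas A -> mmeas B -> mmeas (fun t => A t + B t).
Proof.
by move=> mA mB i j; apply: cmeas_ext (cmeasD (mA i j) (mB i j)) => t; rewrite mxE.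
Qed.

Lemma mmeasZ p q z (A : T -> 'M[R[i]]_(p, q)) : mmeas A -> mmeas (fun t => z *: A t).
Proof.
by move=> mA i j; apply: cmeas_ext (cmeasM (cmeas_cst z) (mA i j)) => t; rewrite mxE.
Qed.

Lemma mmeasB p q (A B : T -> 'M[R[i]]_(p, q)) :
  mmeas A -> mmeas B -> mmeas (fun t => A t - B t).
Proof.
by move=> mA mB i j; apply: cmeas_ext (cmeasB (mA i j) (mB i j)) => t; rewrite !mxE.
Qed.

Lemma mmeas_sum p q (I : finType) (A : I -> T -> 'M[R[i]]_(p, q)) :
  (forall k, mmeas (A k)) -> mmeas (fun t => \sum_k A k t).
Proof.
move=> mA i j.
apply: cmeas_ext (cmeas_sum (index_enum I) xpredT (fun k => mA k i j)) => t.
by rewrite summxE.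
Qed.

Lemma mmeasM p q r (A : T -> 'M[R[i]]_(p, q)) (B : T -> 'M[R[i]]_(q, r)) :
  mmeas A -> mmeas B -> mmeas (fun t => A t *m B t).
Proof.
move=> mA mB i j.
apply: cmeas_ext (cmeas_sum (index_enum _) xpredT (fun k => cmeasM (mA i k) (mB k j))) => t.
by rewrite mxE.
Qed.

Lemma cmeas_det p (A : T -> 'M[R[i]]_p) : mmeas A -> cmeas (fun t => \det (A t)).
Proof.
move=> mA; rewrite /determinant; apply: cmeas_sum => s.
by apply: cmeasM; [exact: cmeas_cst|exact: cmeas_prod].
Qed.

Lemma mmeas_quadmx n N a b c (X : T -> 'I_n -> 'M[R[i]]_N) :
  (forall k, mmeas (X ^~ k)) -> mmeas (fun t => quadmx a b c (X t)).
Proof.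
move=> mX; apply: mmeasD; last exact: mmeas_cst.
apply: mmeasD; last by apply: mmeas_sum => k; exact: mmeasZ.
apply: mmeas_sum => i; apply: mmeas_sum => j; apply: mmeasZ.
exact: mmeasM.
Qed.

End complex_measurability.

Lemma cmeas_comp (R : realType) d d' (T : measurableType d) (T' : measurableType d')
    (f : T -> T') (g : T' -> R[i]) :
  measurable_fun [set: T] f -> cmeas g -> cmeas (g \o f).
Proof.
move=> mf [gr gi]; split.
  exact: (measurableT_comp gr mf).
exact: (measurableT_comp gi mf).
Qed.

Section log_derivative.
Context (R : realType).
Implicit Types (al be ga : R[i]) (e : R).

Lemma normcD_le (x y : R[i]) : normc (x + y) <= normc x + normc y.
Proof. exact: le_normcD. Qed.

Lemma normcN (x : R[i]) : normc (- x) = normc x.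
Proof. exact: normcN. Qed.

Lemma normc_real (x : R) : normc x%:C = `|x|.
Proof. by rewrite /= expr0n /= addr0 sqrtr_sqr. Qed.

Lemma le_Re_normc (x : R[i]) : `|complex.Re x| <= normc x.
Proof.
case: x => a b /=; rewrite -sqrtr_sqr ler_sqrt ?lerDl ?sqr_ge0//.
by rewrite addr_ge0 ?sqr_ge0.
Qed.

Lemma normc_ge0 (x : R[i]) : 0 <= normc x.
Proof. by case: x => a b; exact: sqrtr_ge0. Qed.

Lemma quadratic_roots al be ga : exists r1 r2 : R[i], al != 0 ->
  forall s, al * s ^+ 2 + be * s + ga = al * ((s - r1) * (s - r2)) /\
   al *+ 2 * s + be = al * ((s - r1) + (s - r2)).
Proof.
pose D := sqrtC (be ^+ 2 - 4 * al * ga).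
exists ((- be + D) / (2 * al)), ((- be - D) / (2 * al)) => al0 s.
have DD : D ^+ 2 = be ^+ 2 - 4 * al * ga by rewrite sqrtCK.
split; last by field.
have -> : ga = (be ^+ 2 - D ^+ 2) / (4 * al) by rewrite DD; field.
by field.
Qed.

(** For a quadratic [q] with roots [r1], [r2], [q'/q = 1/(s - r1) + 1/(s - r2)], and a real [s] is
    at least as far from a root as from its real part. If both distances exceed [2 * e], each term
    is below [1/(2e)]. Multiplying out by [q] keeps the inequality meaningful at its zeros. *)
Lemma log_derivative_quadratic al be ga e : 0 < e -> exists x1 x2 : R,
  forall s : R, normc (al * s%:C ^+ 2 + be * s%:C + ga) / e < normc (al *+ 2 * s%:C + be) ->
    `|s - x1| <= 2 * e \/ `|s - x2| <= 2 * e.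
Proof.
move=> e0.
have aux (A n1 n2 m : R) : 2 * e <= n1 -> 2 * e <= n2 -> m <= n1 + n2 -> 0 <= A ->
    A * m * e <= A * (n1 * n2).
  by move=> h1 h2 hm A0; rewrite -mulrA ler_wpM2l//; nra.
have [al0|al0] := eqVneq al 0; last first.
  have [r1 [r2 /(_ al0) rE]] := quadratic_roots al be ga.
  exists (complex.Re r1), (complex.Re r2) => s.
  have [-> ->] := rE s%:C; rewrite !ComplexField.Normc.normcM.
  have Re_le (r : R[i]) : `|s - complex.Re r| <= normc (s%:C - r).
    by apply: le_trans (le_Re_normc _); case: r.
  have := Re_le r1; have := Re_le r2.
  set d1 := `|_ - complex.Re r2|; set d2 := `|_ - complex.Re r1| => h1 h2 h.
  have [?|d1e] := leP d2 (2 * e); first by left.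
  have [?|d2e] := leP d1 (2 * e); first by right.
  have := normcD_le (s%:C - r1) (s%:C - r2).
  move: h; set n1 := normc (_ - r1) in h2 *; set n2 := normc (_ - r2) in h1 *.
  rewrite ltr_pdivrMr// => h hD.
  have A0 := normc_ge0 al.
  exfalso; move: h; rewrite ltNge => /negP; apply.
  apply: aux => //; [exact: le_trans (ltW d1e) h2|exact: le_trans (ltW d2e) h1].
(* A constant never satisfies the strict inequality, so any two centres do. In the linear case below
   there is one root, and the second centre is a dummy. *)
have [be0|be0] := eqVneq be 0.
  exists 0, 0 => s; rewrite al0 be0 !mul0r mul0rn addr0 add0r mul0r add0r.
  have -> : normc (0 : R[i]) = 0 by rewrite /= expr0n addr0 sqrtr0.
  by move=> h; exfalso; move: h; apply/negP; rewrite -leNgt divr_ge0 ?normc_ge0// ltW.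
exists (complex.Re (- ga / be)), 0 => s.
rewrite al0 mul0r mul0rn mul0r !add0r.
have -> : be * s%:C + ga = be * (s%:C - (- ga / be)) by field.
rewrite ComplexField.Normc.normcM ltr_pdivrMr// => h; left.
have b0 : 0 < normc be.
  rewrite lt_def normc_ge0 andbT; apply: contra be0 => /eqP/ComplexField.Normc.eq0_normc ->.
  by rewrite eqxx.
move: h; rewrite ltr_pM2l// => h.
have : `|s - complex.Re (- ga / be)| <= normc (s%:C - (- ga / be)).
  by apply: le_trans (le_Re_normc _); case: (- ga / be).
lra.
Qed.

End log_derivative.

Section measurable_comparison.
Context (R : realType) d (T : measurableType d) (f g : T -> R).
Hypotheses (mf : measurable_fun [set: T] f) (mg : measurable_fun [set: T] g).

Lemma measurable_set_lt : measurable [set t | f t < g t].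
Proof.
have := measurable_fun_ltr mf mg measurableT (_ : measurable [set true]).
by rewrite setTI; exact.
Qed.

Lemma measurable_set_le : measurable [set t | f t <= g t].
Proof.
have := measurable_fun_ler mf mg measurableT (_ : measurable [set true]).
by rewrite setTI; exact.
Qed.

End measurable_comparison.

Section coordinate_derivative.
Context (R : realType) (J : finType).
Implicit Types (w : array R J) (phi : array R J -> R[i]) (r : J).

Definition cshift w r (u : R) : array R J := upd w r (w r + u).

(* The symmetric difference quotient, exact on quadratic functions. *)
Definition dcoord phi r w : R[i] := (phi (cshift w r 1) - phi (cshift w r (-1))) / 2.

Definition quadratic_in phi r := forall w, exists al be ga : R[i],
  forall s : R, phi (upd w r s) = al * s%:C ^+ 2 + be * s%:C + ga.

Lemma measurable_cshift r u : measurable_fun [set: array R J] (fun w => cshift w r u).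
Proof.
apply: measurable_arrayP => j; rewrite /cshift /upd.
case: (eqVneq j r) => _; last exact: measurable_coord.
by apply: measurable_funD => //; exact: measurable_coord.
Qed.

Lemma cmeas_dcoord phi r : cmeas phi -> cmeas (dcoord phi r).
Proof.
move=> mphi; apply: (cmeasM (f := fun w => phi (cshift w r 1) - phi (cshift w r (-1)))).
  by apply: cmeasB; apply: cmeas_comp mphi; exact: measurable_cshift.
exact: cmeas_cst.
Qed.

(** This allows [small_log_derivative] to be applied a second time, to a first derivative. The two
    coordinates may coincide, in which case the quotient is affine. *)
Lemma quadratic_in_dcoord phi r r' : quadratic_in phi r' -> quadratic_in (dcoord phi r) r'.
Proof.
move=> qphi w; have [->|rr'] := eqVneq r r'.
  have [al [be [ga E]]] := qphi w.
  exists 0, (al *+ 2), be => s.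
  rewrite /dcoord /cshift !updE !upd_upd !E !rmorphD /= !rmorphN /= !rmorph1.
  by field.
have [al [be [ga E]]] := qphi (cshift w r 1).
have [al' [be' [ga' E']]] := qphi (cshift w r (-1)).
exists ((al - al') / 2), ((be - be') / 2), ((ga - ga') / 2) => s.
rewrite /dcoord /cshift !upd_neq// ?(updC _ _ _ (_ : r' != r)) 1?eq_sym//.
by rewrite E E'; field.
Qed.

Variable mu : probability (array R J) R.
Hypothesis mu_prod : product_law (@gauss R) mu.

(** Given the other coordinates, the event lies in two intervals of half-length [2 * e], each of
    Gaussian mass at most [4 * e]. *)
Lemma small_log_derivative phi r (e : R) : 0 < e -> cmeas phi -> quadratic_in phi r ->
  small mu [set w | normc (phi w) / e < normc (dcoord phi r w)] (8 * e).
Proof.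
move=> e0 mphi qphi; set E := [set w | _].
have mE : measurable E.
  apply: measurable_set_lt.
    by apply: measurable_funM => //; exact: cmeas_normc.
  by apply: cmeas_normc; exact: cmeas_dcoord.
apply: small_measurable => //.
rewrite -[leRHS]mule1 -(probability_setT mu).
apply: (resample_le mu_prod (r := r)) => //; first by rewrite mulr_ge0// ltW.
move=> w; have [al [be [ga phiE]]] := qphi w.
have [x1 [x2 xP]] := log_derivative_quadratic al be ga e0.
pose I x := [set s : R | `|s - x| <= 2 * e].
have mI x : measurable (I x).
  rewrite (_ : I x = `[x - 2 * e, x + 2 * e]%classic) //.
  by apply/seteqP; split => s; rewrite /I /= in_itv /= ler_distl.
have mS : measurable [set s | E (upd w r s)].
  by have := measurable_upd_fix w r; move=> /(_ measurableT _ mE); rewrite setTI.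
apply: (@le_trans _ _ (gauss (I x1 `|` I x2))).
  apply: le_measure; rewrite ?inE//; first exact: measurableU.
  move=> s; rewrite /E /= /dcoord /cshift !updE !upd_upd !phiE => h; apply: xP.
  apply: lt_le_trans h _; rewrite le_eqVlt; apply/orP; left; apply/eqP.
  by congr normc; rewrite !rmorphD /= !rmorphN /= !rmorph1; field.
apply: (le_trans (measureU2 _ _ _)) => //.
apply: (@le_trans _ _ ((2 * (2 * e))%:E + (2 * (2 * e))%:E)%E).
  by apply: leeD; apply: gauss_interval; rewrite mulr_ge0// ltW.
by rewrite -EFinD lee_fin; lra.
Qed.

End coordinate_derivative.

Section gaussian_matrices.
Context (R : realType) (n N : nat).
Hypothesis N_gt0 : (0 < N)%N.

Definition gcoord : finType := ('I_n * (bool * ('I_N * 'I_N)))%type.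

Let kap : R := (Num.sqrt N%:R)^-1.

Let kap_gt0 : 0 < kap.
Proof. by rewrite invr_gt0 sqrtr_gt0 ltr0n. Qed.

Definition gmx (w : array R gcoord) (k : 'I_n) : 'M[R[i]]_N :=
  \matrix_(i, j) Complex ((Num.sqrt N%:R)^-1 * w (k, (true, (i, j))))
                         ((Num.sqrt N%:R)^-1 * w (k, (false, (i, j)))).

Lemma gmxE w k i j : gmx w k i j =
  Complex ((Num.sqrt N%:R)^-1 * w (k, (true, (i, j))))
          ((Num.sqrt N%:R)^-1 * w (k, (false, (i, j)))).
Proof. by rewrite mxE. Qed.

Lemma mmeas_gmx k : mmeas (gmx ^~ k).
Proof.
move=> i j; split.
  rewrite (_ : (fun _ => _) = fun w : array R gcoord => kap * w (k, (true, (i, j)))).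
    by apply: measurable_funM => //; exact: measurable_coord.
  by apply/funext => w; rewrite mxE.
rewrite (_ : (fun _ => _) = fun w : array R gcoord => kap * w (k, (false, (i, j)))).
  by apply: measurable_funM => //; exact: measurable_coord.
by apply/funext => w; rewrite mxE.
Qed.

Lemma shift_mxD (X : 'I_n -> 'M[R[i]]_N) m D D' :
  shift_mx (shift_mx X m D) m D' = shift_mx X m (D + D').
Proof. by apply/funext => k; rewrite /shift_mx scalerDr addrA. Qed.

(** Only real parts are varied: the determinant is a complex polynomial in the entries, so its
    derivative along a real part is already the full complex derivative. *)
Definition entry (m : 'I_n) (j i : 'I_N) : gcoord := (m, (true, (j, i))).

Lemma gmx_shift (w : array R gcoord) m j i (u : R) : gmx (cshift w (entry m j i) u) =
  shift_mx (gmx w) m ((kap * u)%:C *: (delta_mx j 0 : 'cV_N) *m delta_mx 0 i).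
Proof.
apply/funext => k; apply/matrixP => p q; rewrite !mxE big_ord1 !mxE /cshift /upd /entry.
rewrite !xpair_eqE /= !andbT; apply/eqP; rewrite eq_complex /=.
rewrite andbF; have [->|_] := eqVneq k m; have [->|_] := eqVneq p j;
  have [->|_] := eqVneq q i;
  rewrite /= ?(mulr1, mulr0, mul1r, mul0r, addr0) //= ?andbT ?subr0 ?addr0 ?eqxx //.
by rewrite andbT mulrDr.
Qed.

Variables (a : 'I_n -> 'I_n -> R[i]) (b : 'I_n -> R[i]) (c : R[i]).

Let phi (w : array R gcoord) : R[i] := \det (quadmx a b c (gmx w)).

Let unit_phi w : phi w != 0 -> quadmx a b c (gmx w) \in unitmx.
Proof. by move=> h; rewrite unitmxE unitfE. Qed.

Let phi_shift2 w m i j k (u v : R) : phi w != 0 ->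
  let g := grad a b c (gmx w) m i in let h := hess a b c (gmx w) m i in
  phi (cshift (cshift w (entry m k i) v) (entry m j i) u) = phi w *
   (1 + (kap * u)%:C * g j + (kap * v)%:C * g k
    + (kap * u)%:C ^+ 2 / 2 * h j j + (kap * u)%:C * (kap * v)%:C * h j k
    + (kap * v)%:C ^+ 2 / 2 * h k k).
Proof.
move=> phi0 g h; rewrite /phi !gmx_shift shift_mxD -mulmxDl addrC.
by rewrite det_quadmx_col2 //.
Qed.

Let phi_shift w m i j (u : R) : phi w != 0 ->
  phi (cshift w (entry m j i) u) = phi w *
   (1 + (kap * u)%:C * grad a b c (gmx w) m i j
    + (kap * u)%:C ^+ 2 / 2 * hess a b c (gmx w) m i j j).
Proof.
move=> phi0; have := phi_shift2 m i j j u 0 phi0.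
rewrite {2}/cshift addr0 upd_id => -> /=.
by rewrite mulr0 /= rmorph0 expr0n /=; ring.
Qed.

(** The expansion [phi_shift] needs an invertible base point. One is sought on the line itself; if
    there is none, the determinant vanishes along the whole line. *)
Lemma quadratic_in_phi m i j : quadratic_in phi (entry m j i).
Proof.
move=> w; have [[s0 s00]|H] := pselect (exists s0, phi (upd w (entry m j i) s0) != 0); last first.
  exists 0, 0, 0 => s; rewrite !mul0r !addr0.
  by apply/eqP; apply: contrapT => /negP h; apply: H; exists s.
set w0 := upd w _ s0 in s00.
pose f := phi w0; pose g := grad a b c (gmx w0) m i j.
pose h := hess a b c (gmx w0) m i j j; pose k := kap%:C.
exists (f * (k ^+ 2 / 2 * h)), (f * (k * g - k ^+ 2 * s0%:C * h)),
  (f * (1 - k * s0%:C * g + k ^+ 2 * s0%:C ^+ 2 / 2 * h)) => s.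
have -> : upd w (entry m j i) s = cshift w0 (entry m j i) (s - s0).
  by rewrite /cshift /w0 updE upd_upd addrC subrK.
rewrite phi_shift// -/f -/g -/h rmorphM /= rmorphB /= -/k.
by field.
Qed.

Let dphi w m i j : phi w != 0 ->
  dcoord phi (entry m j i) w = phi w * kap%:C * grad a b c (gmx w) m i j.
Proof.
move=> phi0; rewrite /dcoord !phi_shift// !rmorphM /= rmorphN /= rmorph1.
by field.
Qed.

Let ddphi w m i j k : phi w != 0 ->
  dcoord (dcoord phi (entry m j i)) (entry m k i) w =
  phi w * kap%:C ^+ 2 * hess a b c (gmx w) m i j k.
Proof.
move=> phi0; rewrite /dcoord !phi_shift2// !rmorphM /= rmorphN /= rmorph1.
by field.
Qed.

Variable mu : probability (array R gcoord) R.
Hypothesis mu_prod : product_law (@gauss R) mu.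

(** Each derivative brings a factor [kap = 1 / sqrt N] from the scaling of the entries, hence
    [sqrt N] and [N] in the bounds. The second-order bound chains the logarithmic derivative of the
    first derivative with that of the determinant. The union runs over [n N^2] first and [n N^3]
    second derivatives, at cost [8 * e] each. *)
Lemma small_derivatives (e : R) : 0 < e ->
  small mu [set w | \det (quadmx a b c (gmx w)) != 0 /\ ~ forall m i j,
     normc (grad a b c (gmx w) m i j) <= Num.sqrt N%:R / e /\
     forall k, normc (hess a b c (gmx w) m i j k) <= N%:R / e ^+ 2]
   (16 * n%:R * N%:R ^+ 3 * e).
Proof.
move=> e0.
have mphi : cmeas phi.
  by apply: cmeas_det; apply: mmeas_quadmx => k; exact: mmeas_gmx.
have S1 := small_exists (fun x : 'I_n * ('I_N * 'I_N) =>
  small_log_derivative mu_prod e0 mphi (quadratic_in_phi x.1 x.2.1 x.2.2)).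
have S2 := small_exists (fun x : 'I_n * ('I_N * ('I_N * 'I_N)) =>
  small_log_derivative mu_prod e0
    (cmeas_dcoord (entry x.1 x.2.2.1 x.2.1) mphi)
    (quadratic_in_dcoord (entry x.1 x.2.2.1 x.2.1) (quadratic_in_phi x.1 x.2.1 x.2.2.2))).
apply: small_le (small_sub _ (smallU S1 S2)).
  rewrite !card_prod !card_ord !natrM.
  have : 1 <= N%:R :> R by rewrite ler1n.
  have : 0 <= n%:R :> R by [].
  move: (n%:R) (N%:R) => x y x0 y1.
  have : y ^+ 2 <= y ^+ 3 by rewrite ler_weXn2l.
  have xe : 0 <= x * e by rewrite mulr_ge0// ltW.
  nra.
move=> w [phi0' H]; have phi0 : phi w != 0 by exact: phi0'.
apply: contrapT => /not_orP [/forallNP H1 /forallNP H2].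
apply: H => m i j.
have f0 : 0 < normc (phi w).
  rewrite lt_def normc_ge0 andbT; apply: contra phi0 => /eqP/ComplexField.Normc.eq0_normc ->.
  by rewrite eqxx.
have nk : normc kap%:C = kap by rewrite normc_real gtr0_norm.
have skap : Num.sqrt N%:R = kap^-1 by rewrite invrK.
have G1 l : normc (dcoord phi (entry m l i) w) <= normc (phi w) / e.
  by have := H1 (m, (i, l)); move=> /negP; rewrite -leNgt.
split.
  have := G1 j; rewrite dphi// !ComplexField.Normc.normcM nk -mulrA ler_pM2l// skap.
  by rewrite mulrC -ler_pdivlMr// mulrC.
move=> k; have := H2 (m, (i, (j, k))) => /negP; rewrite -leNgt /= => G2.
have := le_trans G2 (ler_wpM2r (_ : 0 <= e^-1) (G1 j)); rewrite invr_ge0 (ltW e0) => /(_ isT).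
rewrite ddphi// !ComplexField.Normc.normcM nk -!mulrA ler_pM2l//.
have kk : kap * kap = N%:R^-1 by rewrite -invfM -expr2 sqr_sqrtr.
by rewrite mulrA kk mulrC ler_pdivrMr ?ltr0n// -invfM -expr2 mulrC.
Qed.

End gaussian_matrices.

(** * Common approximate eigenvectors *)

Section approximate_eigenvector.
Context (R : realType).

Lemma normc_sum (I : Type) (s : seq I) (P : pred I) (F : I -> R[i]) :
  normc (\sum_(i <- s | P i) F i) <= \sum_(i <- s | P i) normc (F i).
Proof.
elim/big_ind2: _ => //; first by rewrite /= expr0n /= addr0 sqrtr0.
by move=> x1 x2 y1 y2 h1 h2; apply: le_trans (normcD_le _ _) _; exact: lerD.
Qed.

Lemma normc_mulmx (p q N : nat) (A : 'M[R[i]]_(p, N)) (B : 'M[R[i]]_(N, q)) (al be : R) i k :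
  0 <= al -> (forall j, normc (A i j) <= al) -> (forall j, normc (B j k) <= be) ->
  normc ((A *m B) i k) <= N%:R * (al * be).
Proof.
move=> al0 hA hB; rewrite mxE; apply: le_trans (normc_sum _ _ _) _.
rewrite [leRHS](_ : _ = \sum_(j < N) al * be); last first.
  by rewrite sumr_const card_ord mulr_natl.
apply: ler_sum => j _; rewrite ComplexField.Normc.normcM ler_pM ?normc_ge0//.
Qed.

Lemma normc_triangle5 (x1 x2 x3 x4 x5 : R[i]) :
  normc (x1 + x2 + x3 + x4 + x5) <=
  normc x1 + normc x2 + normc x3 + normc x4 + normc x5.
Proof.
do 4 (apply: le_trans (normcD_le _ _) _; rewrite lerD2r) => //.
Qed.

(* With [Y = w S] and [Z = w S S], dividing [hess] by [G i j0 ^+ 2] shows that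
   [E j l = 2 Y_j Y_l - w_j Z_l - w_l Z_j] is small, and
   [(Y_k - Y_j0 w_k)^2 = E k k / 2 - w_k E j0 k + w_k^2 E j0 j0 / 2]. *)
Lemma approx_eigenvector (n N : nat) (a : 'I_n -> 'I_n -> R[i]) b c X (m : 'I_n)
    (i j0 : 'I_N) (A B k1 k2 : R) :
  let G := invmx (quadmx a b c X) in let S := qright a X m in
  let w := (G i j0)^-1 *: row i G in
  let gam := normc (G i j0) in
  1 <= gam -> (forall j, normc (G i j) <= gam) ->
  normc (a m m) <= A -> (forall j k, normc (S j k) <= B) ->
  (forall j, normc (grad a b c X m i j) <= k1) ->
  (forall j k, normc (hess a b c X m i j k) <= k2) ->
  forall k, normc ((w *m S) 0 k - (w *m S) 0 j0 * w 0 k) ^+ 2 <=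
    2 * ((k2 + 2 * A + 4 * N%:R * B * k1) / gam).
Proof.
move=> G S w gam gam1 Gle aA SB gk1 hk2 k.
pose G0 := G i j0.
have gam0 : 0 < gam by apply: lt_le_trans gam1.
have G00 : G0 != 0.
  by apply: contraTneq gam0; rewrite /gam -/G0 => ->; rewrite /= expr0n /= addr0 sqrtr0 ltxx.
have wj0 : w 0 j0 = 1 by rewrite !mxE mulVf.
have w1 j : normc (w 0 j) <= 1.
  rewrite !mxE ComplexField.Normc.normcM ComplexField.Normc.normcV mulrC.
  by rewrite ler_pdivrMr// mul1r.
have B0 : 0 <= B by apply: le_trans (SB j0 j0); exact: normc_ge0.
have k10 : 0 <= k1 by apply: le_trans (gk1 j0); exact: normc_ge0.
have A0 : 0 <= A by apply: le_trans aA; exact: normc_ge0.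
have gE : row i G = G0 *: w by rewrite scalerA divff// scale1r.
move: w wj0 w1 gE => w wj0 w1 gE.
pose Y := w *m S; pose Z := w *m S *m S.
pose d := row i (grad a b c X m).
have dk j : normc (d 0 j) <= k1 by rewrite mxE.
have Yk j : normc (Y 0 j) <= N%:R * B.
  by rewrite -[B]mul1r; apply: normc_mulmx.
have dSk j : normc ((d *m S) 0 j) <= N%:R * (k1 * B) by exact: normc_mulmx.
set eta := _ / gam.
have E j l : normc (2 * (Y 0 j * Y 0 l) - w 0 j * Z 0 l - w 0 l * Z 0 j) <= eta.
  have key : 2 * (Y 0 j * Y 0 l) - w 0 j * Z 0 l - w 0 l * Z 0 j =
     - (hess a b c X m i j l / G0 ^+ 2)
     + a m m * ((i == j)%:R * w 0 l + (i == l)%:R * w 0 j) / G0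
     + (d 0 j * Y 0 l + d 0 l * Y 0 j) / G0
     - w 0 j * (d *m S) 0 l / G0 - w 0 l * (d *m S) 0 j / G0.
    have -> : hess a b c X m i j l =
      a m m * ((i == j)%:R * row i G 0 l + (i == l)%:R * row i G 0 j)
      + (d 0 j * (row i G *m S) 0 l + d 0 l * (row i G *m S) 0 j)
      - (row i G 0 j * (d *m S) 0 l + row i G 0 l * (d *m S) 0 j)
      - 2 * ((row i G *m S) 0 j * (row i G *m S) 0 l)
      + (row i G 0 j * (row i G *m S *m S) 0 l + row i G 0 l * (row i G *m S *m S) 0 j).
      by [].
    have -> : row i G *m S *m S = G0 *: Z by rewrite gE -!scalemxAl.
    have -> : row i G *m S = G0 *: Y by rewrite gE -!scalemxAl.
    rewrite gE.
    have sE (u : 'rV[R[i]]_N) x : (G0 *: u) 0 x = G0 * u 0 x by rewrite mxE.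
    rewrite !sE.
    move: (Y 0 j) (Y 0 l) (Z 0 j) (Z 0 l) (w 0 j) (w 0 l) (d 0 j) (d 0 l)
      ((d *m S) 0 j) ((d *m S) 0 l) => y1 y2 z1 z2 w1' w2' d1 d2 e1 e2.
    by field.
  rewrite key; apply: le_trans (normc_triangle5 _ _ _ _ _) _.
  rewrite !normcN !ComplexField.Normc.normcM !ComplexField.Normc.normcV -/gam.
  rewrite [normc (G0 ^+ 2)]ComplexField.Normc.normcM -/gam.
  rewrite invfM mulrA -!mulrDl ler_wpM2r ?invr_ge0 ?(ltW gam0)//.
  (* This term comes with [1 / gam^2]; as [gam] is at least one, one of the two factors is given
     away. *)
  have H1 : normc (hess a b c X m i j l) / gam <= k2.
    rewrite ler_pdivrMr//; apply: le_trans (hk2 j l) _.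
    by rewrite ler_peMr//; apply: le_trans (hk2 j l); exact: normc_ge0.
  have dl (x : bool) y : normc (w 0 y) <= 1 -> normc (x%:R * w 0 y) <= 1.
    by case: x => h; rewrite ?mul1r// mul0r /= expr0n /= addr0 sqrtr0.
  have H2 : normc (a m m) * normc ((i == j)%:R * w 0 l + (i == l)%:R * w 0 j) <= A * 2.
    rewrite ler_pM ?normc_ge0//; apply: le_trans (normcD_le _ _) _.
    by have -> : (2 : R) = 1 + 1 by []; apply: lerD; apply: dl.
  have H3 : normc (d 0 j * Y 0 l + d 0 l * Y 0 j) <= k1 * (N%:R * B) + k1 * (N%:R * B).
    apply: le_trans (normcD_le _ _) _; rewrite !ComplexField.Normc.normcM.
    by apply: lerD; rewrite ler_pM ?normc_ge0.
  have H4 x y : normc (w 0 x) * normc ((d *m S) 0 y) <= N%:R * (k1 * B).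
    by rewrite -[leRHS]mul1r ler_pM ?normc_ge0.
  apply: (@le_trans _ _ (k2 + A * 2 + (k1 * (N%:R * B) + k1 * (N%:R * B))
     + N%:R * (k1 * B) + N%:R * (k1 * B))); last by lra.
  by rewrite !lerD.
pose Ee j l := 2 * (Y 0 j * Y 0 l) - w 0 j * Z 0 l - w 0 l * Z 0 j.
have sq : (Y 0 k - Y 0 j0 * w 0 k) ^+ 2 =
    Ee k k / 2 - w 0 k * Ee j0 k + w 0 k ^+ 2 * (Ee j0 j0 / 2).
  by rewrite /Ee wj0; field.
have n2 : normc (2 : R[i]) = 2.
  by rewrite -(rmorph_nat (real_complex R) 2) normc_real ger0_norm.
have -> : normc (Y 0 k - Y 0 j0 * w 0 k) ^+ 2 = normc ((Y 0 k - Y 0 j0 * w 0 k) ^+ 2).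
  by rewrite [in RHS]expr2 ComplexField.Normc.normcM expr2.
rewrite sq; apply: le_trans (normcD_le _ _) _.
have wE (x y : R[i]) : normc x <= 1 -> normc y <= eta -> normc (x * y) <= eta.
  by move=> h1 h2; rewrite ComplexField.Normc.normcM -[eta]mul1r ler_pM ?normc_ge0.
have E2 j : normc (Ee j j / 2) <= eta / 2.
  by rewrite ComplexField.Normc.normcM ComplexField.Normc.normcV n2 ler_wpM2r ?invr_ge0// E.
have h1 : normc (Ee k k / 2 - w 0 k * Ee j0 k) <= eta / 2 + eta.
  apply: le_trans (normcD_le _ _) _; rewrite normcN; apply: lerD; first exact: E2.
  by apply: wE; [exact: w1|exact: E].
have h2 : normc (w 0 k ^+ 2 * (Ee j0 j0 / 2)) <= eta / 2.
  rewrite ComplexField.Normc.normcM -[leRHS]mul1r ler_pM ?normc_ge0//.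
  by rewrite expr2 ComplexField.Normc.normcM mulr_ile1 ?normc_ge0.
by apply: le_trans (lerD h1 h2) _; lra.
Qed.

End approximate_eigenvector.

Lemma measurable_abs (R : realType) d (T : measurableType d) (f : T -> R) :
  measurable_fun [set: T] f -> measurable_fun [set: T] (fun t => `|f t|).
Proof. by move=> mf; refine (measurableT_comp (@normr_measurable R setT) mf). Qed.

Lemma le_Im_normc (R : realType) (x : R[i]) : `|complex.Im x| <= normc x.
Proof.
case: x => a b /=; rewrite -sqrtr_sqr ler_sqrt ?lerDr ?sqr_ge0//.
by rewrite addr_ge0 ?sqr_ge0.
Qed.

(** * Tail and small-ball estimates for Gaussian coordinates *)

Section small_balls.
Context (R : realType) (J : finType).
Variable mu : probability (array R J) R.
Hypothesis mu_prod : product_law (@gauss R) mu.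

Lemma small_coord_tail (r : J) (t : R) : 0 <= t ->
  small mu [set w : array R J | t < `|w r|] (2 * expR (- (t ^+ 2 / 2))).
Proof.
move=> t0; set E := [set w | _].
have mE : measurable E.
  apply: measurable_set_lt => //.
  by apply: measurable_abs; exact: measurable_coord.
apply: small_measurable => //.
rewrite -[leRHS]mule1 -(probability_setT mu).
apply: (resample_le mu_prod (r := r)) => //.
move=> w; apply: le_trans (gauss_tail t0).
rewrite (_ : [set s | _] = [set s | t < `|s|])//.
by apply/seteqP; split => s; rewrite /E /= updE.
Qed.

(** The centres [kap r] are insensitive to all coordinates in [rs], so these can be resampled one
    after another, each contributing a factor [2 * q]. *)
Lemma small_many_coords (rs : seq J) (kap : J -> array R J -> R) (q : R) :
  0 <= q -> uniq rs ->
  (forall r, measurable_fun [set: array R J] (kap r)) ->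
  (forall r r' w s, r \in rs -> kap r' (upd w r s) = kap r' w) ->
  small mu [set w : array R J | forall r, r \in rs -> `|w r - kap r w| <= q]
    ((2 * q) ^+ size rs).
Proof.
move=> q0 + mk.
pose A (s : seq J) := [set w : array R J | forall r, r \in s -> `|w r - kap r w| <= q].
have mA s : measurable (A s).
  rewrite (_ : A s = \bigcap_(r in [set` s]) [set w | `|w r - kap r w| <= q]).
    apply: fin_bigcap_measurable; first exact: finite_seq.
    move=> r _; apply: measurable_set_le => //.
    by apply: measurable_abs; apply: measurable_funB => //; exact: measurable_coord.
  by apply/seteqP; split.
move=> urs krs; apply: small_measurable; first exact: mA.
elim: rs urs krs => [_ _|r rs IH /= /andP[rrs urs] krs].
  by rewrite expr0; apply: probability_le1; exact: mA.
rewrite exprS EFinM.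
apply: (@le_trans _ _ ((2 * q)%:E * mu (A rs))%E); last first.
  rewrite lee_wpmul2l ?lee_fin ?mulr_ge0//; apply: IH => //.
  by move=> r1 r2 w s h; apply: krs; rewrite inE h orbT.
apply: (resample_le mu_prod (r := r)); [exact: mulr_ge0|exact: mA|exact: mA| |].
  move=> w s h r' r'rs; have := h r'; rewrite inE r'rs orbT => /(_ isT).
  rewrite krs ?mem_head// upd_neq//.
  by apply: contraNneq rrs => <-.
move=> w; apply: le_trans (gauss_interval (kap r w) q0).
have mS : measurable [set s | A (r :: rs) (upd w r s)].
  by have := measurable_upd_fix w r; move=> /(_ measurableT _ (mA (r :: rs))); rewrite setTI.
apply: le_measure; rewrite ?inE//.
  rewrite (_ : [set s | _] = `[kap r w - q, kap r w + q]%classic)//.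
  by apply/seteqP; split => s; rewrite /= in_itv /= ler_distl.
move=> s /= h; have := h r; rewrite mem_head => /(_ isT).
by rewrite updE krs ?mem_head.
Qed.

End small_balls.

Section fixed_vector.
Context (R : realType) (n N : nat).
Hypothesis N_gt0 : (0 < N)%N.
Variables (a : 'I_n -> 'I_n -> R[i]) (m m' i1 i2 : 'I_n) (Amax : R).
Let Delta := a i1 m * a i2 m' - a i2 m * a i1 m'.
Hypothesis Delta0 : Delta != 0.
Hypothesis aA : forall i j, normc (a i j) <= Amax.
Variable mu : probability (array R (gcoord n N)) R.
Hypothesis mu_prod : product_law (@gauss R) mu.

(* How far [g *m S] is from being the multiple of [g] predicted by the entry
   [j0], when [g 0 j0 = 1]. *)
Definition eigen_defect (S : 'M[R[i]]_N) (g : 'rV[R[i]]_N) (j0 k : 'I_N) : R[i] :=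
  (g *m S) 0 k - (g *m S) 0 j0 * g 0 k.

Variables (g : 'rV[R[i]]_N) (j0 : 'I_N).
Hypothesis gj0 : g 0 j0 = 1.

(* Given all coordinates but those of [rs], the defects of [S_m] and [S_m'] are
   affine in the latter with an invertible 2x2 matrix of coefficients. *)
Let rs : seq (gcoord n N) := [seq ((ib.1, (ib.2, (j0, k))) : gcoord n N) |
  ib <- [:: (i1, true); (i1, false); (i2, true); (i2, false)], k <- enum (predC1 j0)].

Let i12 : i1 != i2.
Proof. by apply: contraNneq Delta0 => E; rewrite /Delta E subr_eq0 mulrC. Qed.

Let size_rs : size rs = (4 * N.-1)%N.
Proof. by rewrite size_allpairs -cardE cardC1 card_ord. Qed.

Let uniq_rs : uniq rs.
Proof.
apply: allpairs_uniq; last first.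
- by move=> [[i b] k] [[i' b'] k'] _ _ /= [-> -> ->].
- exact: enum_uniq.
- by rewrite /= !inE !xpair_eqE !eqxx (negbTE i12) /=.
Qed.

Let mem_rs i (bb : bool) c k : ((i, (bb, (c, k))) : gcoord n N) \in rs =
  ((i == i1) || (i == i2)) && ((c == j0) && (k != j0)).
Proof.
apply/allpairsP/andP => [[[[i' b'] k'] [/= h1 h2 E]]|[ii /andP[/eqP -> kj]]].
  case: E => -> _ -> ->; move: h1 h2.
  rewrite mem_enum !inE eqxx => + ->; rewrite !xpair_eqE.
  by case: (i' == i1) (i' == i2) => -[] //=.
exists ((i, bb), k); split => //=; last by rewrite mem_enum.
by rewrite !inE !xpair_eqE; case: (i == i1) ii => [|/= ->]; case: bb; rewrite ?orbT.
Qed.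

(** Zeroing the coordinates of [rs] plays the role of conditioning on the others: a function of
    [zap w] is constant in the zeroed coordinates. *)
Let zap (w : array R (gcoord n N)) : array R (gcoord n N) :=
  fun r => if r \in rs then 0 else w r.

Let zap_upd r w s : r \in rs -> zap (upd w r s) = zap w.
Proof.
move=> rrs; apply/funext => j; rewrite /zap /upd.
by case: ifP => // jrs; case: eqP => // E; rewrite E rrs in jrs.
Qed.

Let measurable_zap : measurable_fun setT zap.
Proof.
apply: measurable_arrayP => j; rewrite /zap; case: (j \in rs) => //.
exact: measurable_coord.
Qed.

Let gmx_zap w i c k : gmx w i c k = gmx (zap w) i c k +
  (((i == i1) || (i == i2)) && ((c == j0) && (k != j0)))%:R * gmx w i c k.
Proof.
rewrite !gmxE /zap !mem_rs.
case: (_ && _); last by rewrite mul0r addr0.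
by rewrite mulr0 mul1r add0r.
Qed.

Let qright_zap w l c k : qright a (gmx w) l c k = qright a (gmx (zap w)) l c k +
  ((c == j0) && (k != j0))%:R *
    (a i1 l * gmx w i1 c k + a i2 l * gmx w i2 c k).
Proof.
rewrite /qright !summxE.
have -> : \sum_i (a i l *: gmx w i) c k = \sum_i (a i l *: gmx (zap w) i) c k +
    \sum_i ((c == j0) && (k != j0))%:R *
      (((i == i1) || (i == i2))%:R * (a i l * gmx w i c k)).
  rewrite -big_split /=; apply: eq_bigr => i _.
  rewrite !(mxE scalemx_key) [in LHS]gmx_zap mulrDr.
  by congr (_ + _); rewrite -mulnb natrM; ring.
congr (_ + _); rewrite -mulr_sumr; congr (_ * _).
rewrite (bigD1 i1)//= (bigD1 i2)//=; last by rewrite eq_sym.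
rewrite !eqxx orbT !mul1r big1 ?addr0// => i /andP[/negbTE -> /negbTE ->].
by rewrite mul0r.
Qed.

(** The changes sit in row [j0], which [g] weights by one, and outside column [j0], so they reach
    entry [k] of [g *m S] but leave its entry [j0] alone. *)
Let defect_add (S S0 : 'M[R[i]]_N) (y : 'I_N -> 'I_N -> R[i]) k :
  (forall c x, S c x = S0 c x + ((c == j0) && (x != j0))%:R * y c x) -> k != j0 ->
  eigen_defect S g j0 k = eigen_defect S0 g j0 k + y j0 k.
Proof.
move=> SE kj; rewrite /eigen_defect !mxE.
under eq_bigr do rewrite SE mulrDr.
under [X in _ - X * _]eq_bigr do rewrite SE eqxx andbF mul0r addr0.
rewrite big_split /= -!addrA; congr (_ + _); rewrite addrC; congr (_ + _).
rewrite (bigD1 j0)//= eqxx kj gj0 !mul1r big1 ?addr0// => c /negbTE ->.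
by rewrite mul0r mulr0.
Qed.

Let defect_zap w l k : k != j0 ->
  eigen_defect (qright a (gmx w) l) g j0 k =
  eigen_defect (qright a (gmx (zap w)) l) g j0 k +
    (a i1 l * gmx w i1 j0 k + a i2 l * gmx w i2 j0 k).
Proof. exact: defect_add (qright_zap w l). Qed.

Let solve (a1 a2 a1' a2' d d' x1 x2 : R[i]) : a1 * a2' - a2 * a1' != 0 ->
  (a2' * (d + (a1 * x1 + a2 * x2)) - a2 * (d' + (a1' * x1 + a2' * x2)))
     / (a1 * a2' - a2 * a1') = (a2' * d - a2 * d') / (a1 * a2' - a2 * a1') + x1 /\
  (a1 * (d' + (a1' * x1 + a2' * x2)) - a1' * (d + (a1 * x1 + a2 * x2)))
     / (a1 * a2' - a2 * a1') = (a1 * d' - a1' * d) / (a1 * a2' - a2 * a1') + x2.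
Proof. by move=> D0; split; field. Qed.

(** Cramer's rule for the 2x2 system of determinant [Delta]: up to a function of [zap w], the value
    is the entry [(j0, k)] of the Gaussian matrix [i1] or [i2]. *)
Let offset (i : 'I_n) (k : 'I_N) (w : array R (gcoord n N)) : R[i] :=
  let d := eigen_defect (qright a (gmx w) m) g j0 k in
  let d' := eigen_defect (qright a (gmx w) m') g j0 k in
  if i == i1 then (a i2 m' * d - a i2 m * d') / Delta
  else (a i1 m * d' - a i1 m' * d) / Delta.

Let cmeas_offset i k : cmeas (offset i k).
Proof.
have md l : cmeas (fun w => eigen_defect (qright a (gmx w) l) g j0 k).
  have mS : mmeas (fun w => g *m qright a (gmx (n := n) (N := N) w) l).
    apply: mmeasM; first exact: mmeas_cst.
    by apply: mmeas_sum => j; apply: mmeasZ; exact: mmeas_gmx.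
  by apply: cmeasB; [exact: mS|apply: cmeasM; [exact: mS|exact: cmeas_cst]].
by rewrite /offset; case: (i == i1); apply: cmeasM; try exact: cmeas_cst;
  apply: cmeasB; apply: cmeasM => //; exact: cmeas_cst.
Qed.

Let offsetE w i k : k != j0 -> (i == i1) || (i == i2) ->
  offset i k w = offset i k (zap w) + gmx w i j0 k.
Proof.
move=> kj ii; rewrite /offset (defect_zap w m kj) (defect_zap w m' kj).
move: (eigen_defect (qright a (gmx (zap w)) m) g j0 k)
  (eigen_defect (qright a (gmx (zap w)) m') g j0 k) => d d'.
case: eqP ii => [-> _|_ /= /eqP ->].
  exact: (solve _ _ _ _ Delta0).1.
exact: (solve _ _ _ _ Delta0).2.
Qed.

Lemma small_fixed_vector (del : R) : 0 <= del ->
  small mu [set w | forall k, k != j0 ->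
     normc (eigen_defect (qright a (gmx w) m) g j0 k) <= del /\
     normc (eigen_defect (qright a (gmx w) m') g j0 k) <= del]
   ((2 * (Num.sqrt N%:R * (2 * Amax * del / normc Delta))) ^+ (4 * N.-1)).
Proof.
move=> del0.
have A0 : 0 <= Amax by apply: le_trans (aA i1 i1); exact: normc_ge0.
have D0 : 0 < normc Delta.
  rewrite lt_def normc_ge0 andbT; apply: contra Delta0 => /eqP/ComplexField.Normc.eq0_normc ->.
  by rewrite eqxx.
(* Small defects make [offset i k w] small, and [offsetE] writes it as the matrix entry plus its
   value at [zap w]. The centre is minus that value, multiplied by [sqrt N] to return from the entry
   to the Gaussian coordinate. *)
pose kap (r : gcoord n N) (w : array R (gcoord n N)) : R :=
  let x := offset r.1 r.2.2.2 (zap w) in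
  - (Num.sqrt N%:R * if r.2.1 then complex.Re x else complex.Im x).
rewrite -size_rs; apply: small_sub (small_many_coords mu_prod (kap := kap) _ uniq_rs _ _).
- move=> w H [i [bb [c k]]]; rewrite mem_rs => /andP[ii /andP[/eqP -> kj]].
  have [h1 h2] := H k kj.
  have sN : 0 < Num.sqrt N%:R :> R by rewrite sqrtr_gt0 ltr0n.
  have off : normc (offset i k w) <= 2 * Amax * del / normc Delta.
    have bnd (x1 x2 d1 d2 : R[i]) : normc x1 <= Amax -> normc x2 <= Amax ->
        normc d1 <= del -> normc d2 <= del ->
        normc ((x1 * d1 - x2 * d2) / Delta) <= 2 * Amax * del / normc Delta.
      move=> ? ? ? ?; rewrite ComplexField.Normc.normcM ComplexField.Normc.normcV.
      rewrite ler_wpM2r ?invr_ge0 ?(ltW D0)//; apply: le_trans (normcD_le _ _) _.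
      rewrite normcN !ComplexField.Normc.normcM -mulrA mulr_natl mulr2n.
      by apply: lerD; rewrite ler_pM ?normc_ge0.
    by rewrite /offset; case: (i == i1); apply: bnd.
  have -> : w (i, (bb, (j0, k))) - kap (i, (bb, (j0, k))) w = Num.sqrt N%:R *
      (if bb then complex.Re (offset i k w) else complex.Im (offset i k w)).
    rewrite offsetE// gmxE /kap /= opprK.
    have wE x : x = Num.sqrt N%:R * ((Num.sqrt N%:R)^-1 * x) :> R.
      by rewrite mulrA divff ?mul1r// gt_eqF.
    case: (offset i k (zap w)) => x y /=.
    by case: bb => /=; rewrite {1}[w _]wE -mulrDr addrC.
  rewrite normrM (ger0_norm (ltW sN)) ler_pM2l//; apply: le_trans off.
  by case: bb; [exact: le_Re_normc|exact: le_Im_normc].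
- by rewrite mulr_ge0// divr_ge0 ?mulr_ge0// ltW.
- move=> [i [bb [c k]]]; rewrite /kap /=.
  have [mr mi] := cmeas_comp measurable_zap (cmeas_offset i k).
  rewrite (_ : (fun _ => _) = fun w => (- Num.sqrt N%:R) *
      (if bb then complex.Re (offset i k (zap w)) else complex.Im (offset i k (zap w)))).
    by apply: measurable_funM => //; case: bb.
  by apply/funext => w; rewrite mulNr.
- by move=> r r' w s rrs; rewrite /kap zap_upd.
Qed.

End fixed_vector.

(** * A net of vectors normalised at one entry *)

Section net.
Context (R : realType).

(** The ninth power is the one met in [net_estimate]: [N] choices of [j0] times one leftover factor
    [K^2] with [K] of order [N^4]. *)
Lemma exp_ge_pow9 (x : R) : 0 <= x -> x ^+ 9 <= 9 ^+ 9 * expR x.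
Proof.
move=> x0.
have h : x / 9 <= expR (x / 9) by apply: le_trans (expR_ge1Dx _); rewrite lerDr.
have x90 : 0 <= x / 9 by rewrite divr_ge0.
have := lerXn2r 9 (x90 : _ \is Num.nneg) (expR_ge0 _ : _ \is Num.nneg) h.
rewrite -expRM_natl expr_div_n ler_pdivrMr ?exprn_gt0//.
have -> : (9%:R * (x / 9) : R) = x by field.
by rewrite mulrC.
Qed.

Lemma exists_grid (K : nat) (x : R) : (0 < K)%N -> `|x| <= 1 ->
  exists t : 'I_(2 * K).+1, `|x - (t%:R / K%:R - 1)| <= K%:R^-1.
Proof.
move=> K0 x1; pose y := (x + 1) * K%:R.
have K0' : 0 < K%:R :> R by rewrite ltr0n.
move: x1; rewrite ler_norml => /andP[x1 x2].
have y0 : 0 <= y by rewrite /y mulr_ge0//; lra.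
have /andP[t1 t2] := truncn_itv y0.
have tK : (Num.truncn y < (2 * K).+1)%N.
  rewrite ltnS -(ler_nat R); apply: le_trans t1 _.
  by rewrite /y natrM ler_pM2r//; lra.
exists (Ordinal tK) => /=.
have -> : x - ((Num.truncn y)%:R / K%:R - 1) = (y - (Num.truncn y)%:R) / K%:R.
  by rewrite /y; field; rewrite gt_eqF.
rewrite normrM normfV (gtr0_norm K0') -[leRHS]mul1r ler_wpM2r ?invr_ge0 ?ltW//.
rewrite ger0_norm ?subr_ge0//.
by move: t2; rewrite -addn1 natrD => t2; lra.
Qed.

Lemma normc_le_ReIm (x : R[i]) : normc x <= `|complex.Re x| + `|complex.Im x|.
Proof.
case: x => x y /=.
rewrite -[leRHS]ger0_norm ?addr_ge0// -sqrtr_sqr ler_sqrt ?sqr_ge0//.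
rewrite -[x ^+ 2]real_normK ?num_real// -[y ^+ 2]real_normK ?num_real//.
by have : 0 <= `|x| * `|y| by []; nra.
Qed.

(** Entry [j0] is exactly one rather than a rounded value, as [small_fixed_vector] requires of its
    vector. *)
Definition grid_point (N K : nat) (j0 : 'I_N)
    (f : {ffun 'I_N -> 'I_(2 * K).+1 * 'I_(2 * K).+1}) : 'rV[R[i]]_N :=
  \row_j if j == j0 then 1 else
    Complex ((f j).1%:R / K%:R - 1) ((f j).2%:R / K%:R - 1).

Lemma grid_approx (N K : nat) (j0 : 'I_N) (v : 'rV[R[i]]_N) : (0 < K)%N ->
  v 0 j0 = 1 -> (forall j, normc (v 0 j) <= 1) ->
  exists f, forall j, normc ((v - @grid_point N K j0 f) 0 j) <= 2 / K%:R.
Proof.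
move=> K0 vj v1.
have /choice[f1 f1P] j : exists t : 'I_(2 * K).+1,
    `|complex.Re (v 0 j) - (t%:R / K%:R - 1)| <= K%:R^-1.
  by apply: exists_grid => //; apply: le_trans (v1 j); exact: le_Re_normc.
have /choice[f2 f2P] j : exists t : 'I_(2 * K).+1,
    `|complex.Im (v 0 j) - (t%:R / K%:R - 1)| <= K%:R^-1.
  by apply: exists_grid => //; apply: le_trans (v1 j); exact: le_Im_normc.
exists [ffun j => (f1 j, f2 j)] => j; rewrite !mxE.
have [->|_] := eqVneq j j0.
  by rewrite vj subrr /= expr0n /= addr0 sqrtr0 divr_ge0.
rewrite ffunE; apply: le_trans (normc_le_ReIm _) _.
move: (f1P j) (f2P j); case: (v 0 j) => x y /= h1 h2.
by apply: le_trans (lerD h1 h2) _; lra.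
Qed.

Lemma grid_point_j0 (N K : nat) (j0 : 'I_N) f : @grid_point N K j0 f 0 j0 = 1.
Proof. by rewrite mxE eqxx. Qed.

(** With [g = v - u], the defect changes by three terms linear in [u]; they cost [1], [1] and [3]
    times [N B t], the [3] bounding the entries of [g]. *)
Lemma defect_approx (N : nat) (S : 'M[R[i]]_N) (v g : 'rV[R[i]]_N) j0 k (B t : R) :
  0 <= t -> t <= 2 -> (forall c x, normc (S c x) <= B) ->
  (forall j, normc (v 0 j) <= 1) -> (forall j, normc ((v - g) 0 j) <= t) ->
  normc (eigen_defect S g j0 k) <= normc (eigen_defect S v j0 k) + 5 * N%:R * B * t.
Proof.
move=> t0 t2 SB v1 vg; pose u := v - g.
have B0 : 0 <= B by apply: le_trans (SB j0 j0); exact: normc_ge0.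
have -> : eigen_defect S g j0 k = eigen_defect S v j0 k + (- (u *m S) 0 k)
    + (v *m S) 0 j0 * u 0 k + (u *m S) 0 j0 * g 0 k + 0.
  have -> : g = v - u by rewrite /u opprB addrC subrK.
  rewrite /eigen_defect mulmxBl.
  have sE (x y : 'rV[R[i]]_N) l : (x - y) 0 l = x 0 l - y 0 l by rewrite !mxE.
  by rewrite !sE; ring.
apply: le_trans (normc_triangle5 _ _ _ _ _) _.
have uS l : normc ((u *m S) 0 l) <= N%:R * (t * B) by exact: normc_mulmx.
have vS l : normc ((v *m S) 0 l) <= N%:R * (1 * B) by exact: normc_mulmx.
have g3 : normc (g 0 k) <= 3.
  have -> : g 0 k = v 0 k - u 0 k by rewrite !mxE opprB addrC subrK.
  apply: le_trans (normcD_le _ _) _; rewrite normcN.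
  by have := v1 k; have := vg k; rewrite -/u; lra.
have n0 : normc (0 : R[i]) = 0 by rewrite /= expr0n addr0 sqrtr0.
rewrite n0 addr0 normcN !ComplexField.Normc.normcM.
have h2 : normc ((v *m S) 0 j0) * normc (u 0 k) <= N%:R * (1 * B) * t.
  by rewrite ler_pM ?normc_ge0.
have h3 : normc ((u *m S) 0 j0) * normc (g 0 k) <= N%:R * (t * B) * 3.
  by rewrite ler_pM ?normc_ge0.
rewrite -!addrA lerD2l.
apply: le_trans (lerD (uS k) (lerD h2 h3)) _.
by lra.
Qed.

End net.

Section common_eigenvector.
Context (R : realType) (n : nat).
Variables (a : 'I_n -> 'I_n -> R[i]).

Definition coef_bound : R := 1 + \sum_i \sum_j normc (a i j).

Lemma le_coef_bound i j : normc (a i j) <= coef_bound.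
Proof.
rewrite /coef_bound (bigD1 i)//= (bigD1 j)//= addrCA -addrA lerDl.
by rewrite !addr_ge0//; apply: sumr_ge0 => *; rewrite ?normc_ge0// sumr_ge0// => *;
  exact: normc_ge0.
Qed.

Lemma coef_bound_ge1 : 1 <= coef_bound.
Proof. by rewrite lerDl; apply: sumr_ge0 => i _; apply: sumr_ge0 => j _; exact: normc_ge0. Qed.

Lemma gmx_bounded N (w : array R (gcoord n N)) k i j : (0 < N)%N ->
  (forall r, `|w r| <= 2 * Num.sqrt N%:R) -> normc (gmx w k i j) <= 4.
Proof.
move=> N0 wN; rewrite gmxE; apply: le_trans (normc_le_ReIm _) _ => /=.
have s0 : 0 < Num.sqrt N%:R :> R by rewrite sqrtr_gt0 ltr0n.
have h r : `|(Num.sqrt N%:R)^-1 * w r| <= 2.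
  by rewrite normrM normfV (gtr0_norm s0) mulrC ler_pdivrMr.
by apply: le_trans (lerD (h _) (h _)) _; lra.
Qed.

Lemma qright_bounded N (w : array R (gcoord n N)) l i j : (0 < N)%N ->
  (forall r, `|w r| <= 2 * Num.sqrt N%:R) ->
  normc (qright a (gmx w) l i j) <= 4 * n%:R * coef_bound.
Proof.
move=> N0 wN; rewrite /qright summxE; apply: le_trans (normc_sum _ _ _) _.
rewrite [leRHS](_ : _ = \sum_(k < n) (coef_bound * 4)); last first.
  by rewrite sumr_const card_ord -mulr_natl; ring.
apply: ler_sum => k _; rewrite mxE ComplexField.Normc.normcM ler_pM ?normc_ge0 ?le_coef_bound//.
exact: gmx_bounded.
Qed.

(* The net has [O(K^2)^N] points and each has probability [O(N^2/K)^(4(N-1))]. *)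
Lemma net_estimate (C5 : R) : 0 <= C5 -> exists (K0 : nat) (C : R), (0 < K0)%N /\ 0 < C /\
  forall (N : nat) (b : R), (0 < N)%N -> 0 <= b ->
    let K := (K0 * N ^ 4)%N in
    b <= C5 * N%:R ^+ 2 / K%:R ->
    N%:R * ((2 * K).+1%:R ^+ 2) ^+ N * b ^+ (4 * N.-1) <= C * expR (- N%:R).
Proof.
(* [K0] makes [3 C5^2 / K0] at most [1/e]. As [N^4 / K = 1 / K0], one entry of the net together with
   its four coordinates contributes at most [exp(-2)]. The [N - 1] entries give [exp(-2(N-1))], and
   one of its two factors [exp(-N)] absorbs the leftover polynomial of order [N^9]. *)
move=> C50; pose K0 := (Num.truncn (3 * C5 ^+ 2 * expR 1)).+1.
have K0P : 3 * C5 ^+ 2 * expR 1 <= K0%:R.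
  have /truncn_itv/andP[_ h] : 0 <= 3 * C5 ^+ 2 * expR 1.
    by rewrite !mulr_ge0 ?expR_ge0 ?sqr_ge0.
  exact: ltW.
exists K0, (9 * K0%:R ^+ 2 * expR 2 * 9%:R ^+ 9); split => //; split.
  by rewrite !mulr_gt0 ?expR_gt0 ?exprn_gt0 ?ltr0n.
move=> N b N0 b0 K bK.
have K00 : 1 <= K0%:R :> R by rewrite ler1n.
have x1 : 1 <= N%:R :> R by rewrite ler1n.
have KE : K%:R = K0%:R * N%:R ^+ 4 :> R by rewrite /K natrM natrX.
have [N' NE] : exists N', N = N'.+1 by case: (N) N0 => // N' _; exists N'.
have K1 : 1 <= K%:R :> R.
  by rewrite KE -[leLHS]mulr1 ler_pM// exprn_ege1.
have S3 : (2 * K).+1%:R ^+ 2 <= 9 * K%:R ^+ 2 :> R.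
  rewrite -natr1 natrM; move: (K%:R) K1 => k k1; nra.
have Kpos : 0 < K%:R :> R by lra.
have b4 : b ^+ 4 <= (C5 * N%:R ^+ 2 / K%:R) ^+ 4 by rewrite lerXn2r ?nnegrE// (le_trans b0).
have step : (2 * K).+1%:R ^+ 2 * b ^+ 4 <= expR (- 2).
  apply: (@le_trans _ _ (9 * K%:R ^+ 2 * (C5 * N%:R ^+ 2 / K%:R) ^+ 4)).
    by rewrite ler_pM ?exprn_ge0.
  rewrite [leLHS](_ : _ = (3 * C5 ^+ 2) ^+ 2 * (N%:R ^+ 4 / K%:R) ^+ 2); last first.
    by field; rewrite gt_eqF.
  have -> : N%:R ^+ 4 / K%:R = K0%:R^-1 :> R.
    by rewrite KE; field; rewrite !gt_eqF//; lra.
  rewrite -exprMn.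
  have -> : expR (- 2) = expR (- 1) ^+ 2 :> R.
    by rewrite -expRM_natl; congr expR; lra.
  rewrite lerXn2r ?nnegrE ?expR_ge0 ?divr_ge0 ?mulr_ge0 ?sqr_ge0//.
  rewrite ler_pdivrMr; last by lra.
  by rewrite expRN [leRHS]mulrC ler_pdivlMr ?expR_gt0.
have -> : N%:R * ((2 * K).+1%:R ^+ 2) ^+ N * b ^+ (4 * N.-1) =
    N%:R * (2 * K).+1%:R ^+ 2 * ((2 * K).+1%:R ^+ 2 * b ^+ 4) ^+ N.-1 :> R.
  rewrite NE /= exprM; move: ((2 * K).+1%:R ^+ 2) (b ^+ 4) => A B.
  by rewrite exprS exprMn !mulrA.
apply: (@le_trans _ _ (N%:R * (9 * K%:R ^+ 2) * expR (- 2) ^+ N.-1)).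
  have sb0 : 0 <= (2 * K).+1%:R ^+ 2 * b ^+ 4 by rewrite mulr_ge0// exprn_ge0.
  rewrite ler_pM ?mulr_ge0 ?exprn_ge0//.
    by rewrite ler_wpM2l.
  by rewrite lerXn2r ?nnegrE ?expR_ge0.
have -> : expR (- 2) ^+ N.-1 = expR 2 * expR (- N%:R) * expR (- N%:R) :> R.
  rewrite -expRM_natl -!expRD; congr expR.
  have -> : N%:R = N.-1%:R + 1 :> R by rewrite natr1 prednK.
  by ring.
rewrite KE; have := exp_ge_pow9 (ler0n R N).
move=> h9; have h9' : N%:R ^+ 9 * expR (- N%:R) <= 9%:R ^+ 9 :> R.
  by rewrite expRN ler_pdivrMr ?expR_gt0.
rewrite [leLHS](_ : _ = (9 * K0%:R ^+ 2 * expR 2) *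
  (N%:R ^+ 9 * expR (- N%:R)) * expR (- N%:R)); last by ring.
rewrite ler_wpM2r ?expR_ge0// ler_wpM2l// !mulr_ge0 ?expR_ge0 ?exprn_ge0//.
Qed.

Lemma small_common_eigenvector (m m' i1 i2 : 'I_n) :
  a i1 m * a i2 m' - a i2 m * a i1 m' != 0 ->
  exists (K0 : nat) (C : R), (0 < K0)%N /\ 0 < C /\
  forall (N : nat), (0 < N)%N ->
  forall mu : probability (array R (gcoord n N)) R, product_law (@gauss R) mu ->
  small mu [set w | (forall r, `|w r| <= 2 * Num.sqrt N%:R) /\
    exists (v : 'rV[R[i]]_N) (j0 : 'I_N), v 0 j0 = 1 /\ (forall j, normc (v 0 j) <= 1) /\
      forall k, normc (eigen_defect (qright a (gmx w) m) v j0 k) <= (K0 * N ^ 4)%:R^-1 /\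
        normc (eigen_defect (qright a (gmx w) m') v j0 k) <= (K0 * N ^ 4)%:R^-1]
    (C * expR (- N%:R)).
Proof.
move=> Delta0; set Delta := _ - _ in Delta0.
pose A := coef_bound; pose B := 4 * n%:R * A.
have A1 : 1 <= A by exact: coef_bound_ge1.
have B0 : 0 <= B by rewrite !mulr_ge0// ltW// (lt_le_trans _ A1).
have D0 : 0 < normc Delta.
  rewrite lt_def normc_ge0 andbT; apply: contra Delta0 => /eqP/ComplexField.Normc.eq0_normc ->.
  by rewrite eqxx.
(* With [sqrt N <= N], the base [2 sqrt N (2 A del / |Delta|)] of [small_fixed_vector] is at most
   [C5 N^2 / K], the form asked by [net_estimate]. *)
pose C5 := 4 * A * (1 + 10 * B) / normc Delta.
have A0 : 0 <= A by exact: le_trans A1.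
have B10 : 0 <= 1 + 10 * B by rewrite addr_ge0// mulr_ge0.
have C50 : 0 <= C5 by rewrite /C5 divr_ge0 ?(ltW D0)// !mulr_ge0.
have [K0 [C [K00 [C0 est]]]] := net_estimate C50.
exists K0, C; split => //; split => // N N0 mu mu_prod.
pose K := (K0 * N ^ 4)%N.
have Kgt0 : (0 < K)%N by rewrite muln_gt0 K00 expn_gt0 N0.
have K1 : 1 <= K%:R :> R by rewrite ler1n.
have N1 : 1 <= N%:R :> R by rewrite ler1n.
(* The tolerance [1/K] at [v], plus the loss [5 N B (2/K)] incurred by moving to a grid point. *)
pose del := (1 + 10 * B) * N%:R / K%:R.
have del0 : 0 <= del by rewrite /del divr_ge0// mulr_ge0.
have q0 : 0 <= 2 * A * del / normc Delta by rewrite divr_ge0 ?(ltW D0)// !mulr_ge0.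
pose I : finType := ('I_N * {ffun 'I_N -> 'I_(2 * K).+1 * 'I_(2 * K).+1})%type.
have S (x : I) := small_fixed_vector N0 Delta0 le_coef_bound mu_prod
  (grid_point_j0 R x.1 x.2) del0.
apply: small_le (small_sub _ (small_exists S)).
  rewrite card_prod card_ord card_ffun card_prod !card_ord natrM natrX natrM -expr2 -/A.
  apply: est => //; first by apply: mulr_ge0 => //; apply: mulr_ge0; [exact: sqrtr_ge0|exact: q0].
  have sN : Num.sqrt N%:R <= N%:R :> R.
    by rewrite -[leRHS]ger0_norm// -sqrtr_sqr ler_sqrt ?sqr_ge0//; nra.
  rewrite [leRHS](_ : _ = N%:R * (4 * A * del / normc Delta)); last first.
    by rewrite /C5 /del -/K; field; rewrite !gt_eqF//; lra.
  rewrite [leLHS](_ : _ = Num.sqrt N%:R * (4 * A * del / normc Delta)); last by ring.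
  by rewrite ler_wpM2r// divr_ge0 ?(ltW D0)// !mulr_ge0.
move=> w [wN [v [j0 [vj [v1 H]]]]].
have [f fP] := grid_approx Kgt0 vj v1; exists (j0, f) => /= k kj.
have SB l c x : normc (qright a (gmx w) l c x) <= B by exact: qright_bounded.
have appr l : normc (eigen_defect (qright a (gmx w) l) v j0 k) <= K%:R^-1 ->
    normc (eigen_defect (qright a (gmx w) l) (grid_point R j0 f) j0 k) <= del.
  move=> h; have t0 : 0 <= 2 / K%:R :> R by rewrite divr_ge0.
  have t2 : 2 / K%:R <= 2 :> R by rewrite ler_pdivrMr; lra.
  apply: le_trans (defect_approx j0 k t0 t2 (SB l) v1 fP) _.
  apply: le_trans (lerD h (lexx _)) _.
  rewrite [leLHS](_ : _ = (1 + 10 * N%:R * B) / K%:R); last by ring.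
  rewrite /del ler_wpM2r ?invr_ge0//; nra.
by have [h1 h2] := H k; split; apply: appr.
Qed.

(** At the threshold [2 sqrt N] one coordinate has tail [2 exp(-2N)], and one factor [exp(-N)]
    absorbs the count [2 n N^2] of coordinates. *)
Lemma small_unbounded N (mu : probability (array R (gcoord n N)) R) :
  (0 < N)%N -> product_law (@gauss R) mu ->
  small mu [set w | ~ forall r, `|w r| <= 2 * Num.sqrt N%:R]
    (4 * n%:R * 9%:R ^+ 9 * expR (- N%:R)).
Proof.
move=> N0 mu_prod.
have S (r : gcoord n N) := small_coord_tail mu_prod r
  (mulr_ge0 (ler0n R 2) (sqrtr_ge0 (N%:R : R))).
have N1 : 1 <= N%:R :> R by rewrite ler1n.
apply: small_le (small_sub _ (small_exists S)).
  rewrite /gcoord !card_prod card_bool !card_ord !natrM.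
  have -> : (2 * Num.sqrt N%:R) ^+ 2 / 2 = N%:R + N%:R :> R.
    by rewrite exprMn sqr_sqrtr//; field.
  rewrite opprD expRD.
  have h : N%:R ^+ 9 * expR (- N%:R) <= 9%:R ^+ 9 :> R.
    by rewrite expRN ler_pdivrMr ?expR_gt0//; exact: exp_ge_pow9.
  have h2 : N%:R ^+ 2 <= N%:R ^+ 9 :> R by rewrite ler_weXn2l.
  have e0 : 0 < expR (- N%:R) :> R by exact: expR_gt0.
  rewrite [leLHS](_ : _ = 4 * n%:R * (N%:R ^+ 2 * expR (- N%:R)) * expR (- N%:R)); last by ring.
  rewrite ler_wpM2r ?(ltW e0)// ler_wpM2l ?mulr_ge0//.
  by apply: le_trans h; rewrite ler_wpM2r// ltW.
move=> w /existsNP[r /negP]; rewrite -ltNge => h.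
by exists r.
Qed.

End common_eigenvector.

(** * Generic scalar shifts avoiding the spectrum *)

Section perturbation.
Context (R : realType) (J : finType) (N : nat).
Variable mu : probability (array R J) R.

Lemma det_sub_scalar_eq0 (A : 'M[R[i]]_N) x :
  \det (A - x%:M) = 0 -> root (char_poly A) x.
Proof.
move=> d0; rewrite -eigenvalue_root_char /eigenvalue kermx_eq0 row_free_unit.
by rewrite unitmxE unitfE d0 eqxx.
Qed.

(* For distinct shifts the events have bounded overlap: a matrix has at most
   [N] eigenvalues. *)
Lemma exists_generic_shift (A : array R J -> 'M[R[i]]_N) (eta l0 : R) :
  mmeas A -> 0 < eta -> 0 < l0 ->
  exists2 l : R, 0 < l <= l0 &
    small mu [set w | \det (A w - l%:C%:M) = 0] eta.
Proof.
(* There are more than [N / eta] candidate shifts: if each event had probability above [eta], the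
   expected number of events that occur would exceed [N]. *)
move=> mA eta0 l00; pose n := (Num.truncn (N%:R / eta)).+1.
have nP : N%:R < n%:R * eta.
  have /truncn_itv/andP[_ h] : 0 <= N%:R / eta by rewrite divr_ge0// ltW.
  by rewrite -ltr_pdivrMr.
pose l (j : 'I_n) : R := l0 * (j.+1%:R / n%:R).
have n0 : 0 < n%:R :> R by rewrite ltr0n.
have linj : injective l.
  move=> j j' /(mulfI (lt0r_neq0 l00)) /(mulIf (invr_neq0 (lt0r_neq0 n0))) /eqP.
  by rewrite eqr_nat eqSS => /eqP/val_inj.
pose E j := [set w | \det (A w - (l j)%:C%:M) = 0].
have mE j : measurable (E j).
  rewrite (_ : E j = [set w | normc (\det (A w - (l j)%:C%:M)) <= 0]).
    apply: measurable_set_le => //; apply: cmeas_normc; apply: cmeas_det.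
    by apply: mmeasB => //; exact: mmeas_cst.
  apply/seteqP; split => w /=; rewrite /E /=.
    by move=> ->; rewrite /= expr0n /= addr0 sqrtr0.
  by move=> h; apply: ComplexField.Normc.eq0_normc; apply/eqP; rewrite eq_le h normc_ge0.
have overlap w : \sum_(j < n) \1_(E j) w <= N%:R :> R.
  pose s := [seq (l j)%:C | j <- enum 'I_n & w \in E j].
  have : (size s < size (char_poly (A w)))%N.
    apply: max_poly_roots.
    - by rewrite -size_poly_gt0 size_char_poly.
    - apply/allP => _ /mapP[j + ->]; rewrite mem_filter => /andP[wE _].
      by apply: det_sub_scalar_eq0; move: wE; rewrite inE.
    - rewrite map_inj_uniq; first by apply: filter_uniq; rewrite enum_uniq.
      by move=> j j' /complexI/linj.
  rewrite size_char_poly ltnS size_map size_filter -(ler_nat R).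
  apply: le_trans; rewrite -sum1_count natr_sum.
  rewrite big_enum_cond /= [leRHS]big_mkcond; apply: ler_sum => j _.
  by rewrite indicE; case: (w \in E j).
have [[j Ej]|H] := pselect (exists j, (mu (E j) <= eta%:E)%E).
  exists (l j); last by apply: small_measurable; [exact: mE|exact: Ej].
  rewrite /l mulr_gt0 ?divr_gt0 ?ltr0n//= ler_piMr ?(ltW l00)//.
  by rewrite ler_pdivrMr// mul1r ler_nat.
exfalso.
have : (\int[mu]_w (\sum_(j < n) (\1_(E j) w)%:E) <= N%:R%:E)%E.
  apply: (@le_trans _ _ (\int[mu]_w (N%:R : R)%:E)%E); last first.
    by rewrite integral_cst// -[leRHS]mule1 lee_wpmul2l ?lee_fin//; exact: probability_le1.
  apply: ge0_le_integral => //.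
  - by move=> w _; apply: sume_ge0 => j _; rewrite lee_fin.
  - by apply: emeasurable_sum => j; apply/measurable_EFinP; exact: measurable_indic.
  - by move=> w _; rewrite sumEFin lee_fin.
rewrite ge0_integral_sum//; last first.
  by move=> j; apply/measurable_EFinP; exact: measurable_indic.
apply/negP; rewrite -ltNge.
apply: (@lt_le_trans _ _ (n%:R * eta)%:E); first by rewrite lte_fin.
have -> : (n%:R * eta)%:E = (\sum_(j < n) eta%:E)%E.
  by rewrite sumEFin sumr_const card_ord mulr_natl.
apply: lee_sum => j _; rewrite integral_indic ?setIT//.
by rewrite leNgt; apply/negP => h; apply: H; exists j; exact: ltW.
Qed.

End perturbation.

Lemma exists_max_entry (R : realType) (N : nat) (G : 'M[R[i]]_N) : (0 < N)%N ->
  exists i0 j0, forall i j, normc (G i j) <= normc (G i0 j0).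
Proof.
move=> N0; pose x0 := Ordinal N0.
have := @arg_maxP _ _ _ (x0, x0) xpredT (fun x => normc (G x.1 x.2)) isT.
case=> -[i0 j0] _ H; exists i0, j0 => i j; exact: (H (i, j)).
Qed.

(** * Tail of the resolvent, and the case of rank at least two *)

Section resolvent.
Context (R : realType) (n : nat).
Variables (a : 'I_n -> 'I_n -> R[i]) (b : 'I_n -> R[i]).

(** [c] is quantified after [C] because it will absorb [z] and the generic shift. The determinant is
    required to be nonzero since [invmx] is a true inverse only there. [N^10] is [N^8], from the
    squared tolerance [1 / (K0 N^4)], times [N^2], from [hess_remainder_le]. *)
Definition resolvent_tail (C : R) := forall N : nat, (0 < N)%N ->
  forall mu : probability (array R (gcoord n N)) R, product_law (@gauss R) mu ->
  forall (c : R[i]) (e : R), 0 < e -> e <= 1 ->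
  small mu [set w | \det (quadmx a b c (gmx w)) != 0 /\
      exists i j, C * N%:R ^+ 10 / e ^+ 2 < normc (invmx (quadmx a b c (gmx w)) i j)]
    (C * (N%:R ^+ 4 * e + expR (- N%:R))).

Let A : R := coef_bound a.
Let B : R := 4 * n%:R * A.
Let A1 : 1 <= A. Proof. exact: coef_bound_ge1. Qed.
Let B0 : 0 <= B. Proof. by rewrite !mulr_ge0// (le_trans _ A1). Qed.

Lemma hess_remainder_le (N : nat) (e : R) : (0 < N)%N -> 0 < e -> e <= 1 ->
  N%:R / e ^+ 2 + 2 * A + 4 * N%:R * B * (Num.sqrt N%:R / e) <=
  (1 + 2 * A + 4 * B) * (N%:R ^+ 2 / e ^+ 2).
Proof.
move=> N0 e0 e1; have N1 : 1 <= N%:R :> R by rewrite ler1n.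
have sN : Num.sqrt N%:R <= N%:R :> R.
  by rewrite -[leRHS]ger0_norm// -sqrtr_sqr ler_sqrt ?sqr_ge0//; nra.
have s0 : 0 <= Num.sqrt N%:R :> R by exact: sqrtr_ge0.
have ei : 1 <= e^-1 by rewrite invf_ge1.
rewrite -exprVn; set x := e^-1 in ei *; set y := N%:R in N1 sN s0 *; set s := Num.sqrt _ in s0 sN *.
move: x y s ei s0 sN N1 => x y s x1 s0 sy y1.
have x2 : 1 <= x ^+ 2 by rewrite exprn_ege1.
have xx2 : x <= x ^+ 2 by rewrite expr2 ler_peMl//; lra.
have y2 : y <= y ^+ 2 by rewrite expr2 ler_peMl//; lra.
have y21 : 1 <= y ^+ 2 by rewrite exprn_ege1.
have h1 : y * x ^+ 2 <= y ^+ 2 * x ^+ 2 by rewrite ler_wpM2r//; lra.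
have h2 : 1 <= y ^+ 2 * x ^+ 2 by rewrite mulr_ege1.
have h3 : y * (s * x) <= y ^+ 2 * x ^+ 2.
  rewrite mulrA ler_pM//; [by rewrite mulr_ge0//; lra|by lra|].
  by rewrite expr2 ler_wpM2l//; lra.
have h4 : 2 * A <= 2 * A * (y ^+ 2 * x ^+ 2).
  by rewrite ler_peMr// mulr_ge0// (le_trans _ A1).
have h5 : 4 * B * (y * (s * x)) <= 4 * B * (y ^+ 2 * x ^+ 2).
  by rewrite ler_wpM2l// mulr_ge0.
rewrite [leRHS](_ : _ = y ^+ 2 * x ^+ 2 + 2 * A * (y ^+ 2 * x ^+ 2)
  + 4 * B * (y ^+ 2 * x ^+ 2)); last by ring.
rewrite [X in _ + X <= _](_ : _ = 4 * B * (y * (s * x))); last by ring.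
by rewrite !lerD.
Qed.

Lemma resolvent_tail_minor (m m' i1 i2 : 'I_n) :
  a i1 m * a i2 m' - a i2 m * a i1 m' != 0 ->
  exists2 C : R, 0 < C & resolvent_tail C.
Proof.
move=> Delta0; have [K0 [C1 [K00 [C10 net]]]] := small_common_eigenvector Delta0.
(* If the largest entry is at least [C2 N^10 / e^2], [approx_eigenvector] yields a squared defect of
   at most [(K0 N^4)^-2], the tolerance of [small_common_eigenvector]. *)
pose C2 : R := 2 * (1 + 2 * A + 4 * B) * K0%:R ^+ 2.
have K01 : 1 <= K0%:R :> R by rewrite ler1n.
have C21 : 1 <= C2.
  have : 1 <= K0%:R ^+ 2 :> R by rewrite exprn_ege1.
  move=> k1; rewrite /C2 mulr_ege1//.
  by have := A1; have := B0; lra.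
pose C3 : R := C1 + (4 * n%:R * 9%:R ^+ 9 + 16 * n%:R).
have C30 : 0 <= C3 by rewrite !addr_ge0 ?mulr_ge0 ?exprn_ge0// ltW.
exists (C2 + C3); first by lra.
move=> N N0 mu mu_prod c e e0 e1.
have N1 : 1 <= N%:R :> R by rewrite ler1n.
have S := smallU (small_derivatives N0 a b c mu_prod e0)
  (smallU (net N N0 mu mu_prod) (small_unbounded N0 mu_prod)).
apply: small_le (small_sub _ S).
  have e34 : N%:R ^+ 3 * e <= N%:R ^+ 4 * e by rewrite ler_wpM2r ?ler_weXn2l// ltW.
  have x0 : 0 <= N%:R ^+ 4 * e by rewrite mulr_ge0 ?exprn_ge0// ltW.
  have y0 : 0 <= expR (- N%:R) :> R by exact: expR_ge0.
  have z0 : 0 <= 4 * n%:R * 9%:R ^+ 9 :> R by rewrite !mulr_ge0 ?exprn_ge0.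
  have n0 : 0 <= n%:R :> R by [].
  rewrite -mulrA /C3; move: (4 * n%:R * 9%:R ^+ 9) z0 => z z0.
  move: (N%:R ^+ 4 * e) (N%:R ^+ 3 * e) (expR (- N%:R)) (n%:R) e34 x0 y0 n0 => x x' y k xx x0 y0 k0.
  have h1 : 16 * k * x' <= 16 * k * x by rewrite ler_wpM2l// mulr_ge0.
  have h2 : 0 <= (C2 + C1 + z) * x by rewrite mulr_ge0//; lra.
  have h3 : 0 <= (C2 + 16 * k) * y by rewrite mulr_ge0//; lra.
  lra.
move=> w [det0 [i [j Gij]]]; apply: contrapT => /not_orP[H1 /not_orP[H2 /contrapT wN]].
have {H1} Hd : forall m i j,
   normc (grad a b c (gmx w) m i j) <= Num.sqrt N%:R / e /\
   forall k, normc (hess a b c (gmx w) m i j k) <= N%:R / e ^+ 2.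
  by apply: contrapT => h; apply: H1.
apply: H2; split => //.
set G := invmx _ in Gij.
have [i0 [j0 Gmax]] := exists_max_entry G N0.
exists ((G i0 j0)^-1 *: row i0 G), j0.
have xi0 : 0 < N%:R ^+ 10 / e ^+ 2 :> R by rewrite divr_gt0 ?exprn_gt0//; lra.
have gC : C2 * (N%:R ^+ 10 / e ^+ 2) <= normc (G i0 j0).
  apply: le_trans (Gmax i j); apply: le_trans (ltW Gij).
  by rewrite -mulrA ler_wpM2r ?(ltW xi0)//; lra.
have xi1 : 1 <= N%:R ^+ 10 / e ^+ 2 :> R.
  rewrite ler_pdivlMr ?exprn_gt0// mul1r; apply: (@le_trans _ _ 1).
    by rewrite exprn_ile1// ltW.
  by rewrite exprn_ege1.
have g1 : 1 <= normc (G i0 j0).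
  by apply: le_trans gC; rewrite mulr_ege1.
have g0 : 0 < normc (G i0 j0) by apply: lt_le_trans g1.
have G0 : G i0 j0 != 0.
  by apply: contraTneq g0 => ->; rewrite /= expr0n /= addr0 sqrtr0 ltxx.
split; first by rewrite !mxE mulVf.
split.
  move=> l; rewrite !mxE ComplexField.Normc.normcM ComplexField.Normc.normcV mulrC.
  by rewrite ler_pdivrMr// mul1r.
have K0' : 0 < (K0 * N ^ 4)%:R :> R by rewrite ltr0n muln_gt0 K00 expn_gt0 N0.
have main l k :
    normc (eigen_defect (qright a (gmx w) l) ((G i0 j0)^-1 *: row i0 G) j0 k) <= (K0 * N ^ 4)%:R^-1.
  have SB x y := qright_bounded a l x y N0 wN.
  have := approx_eigenvector g1 (Gmax i0) (le_coef_bound a l l) SB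
     (fun j => (Hd l i0 j).1) (fun j k => (Hd l i0 j).2 k) k.
  rewrite -/(eigen_defect _ _ _ _) => h.
  rewrite -(@ler_pXn2r _ 2)// ?nnegrE ?normc_ge0 ?invr_ge0 ?(ltW K0')//.
  apply: le_trans h _.
  rewrite mulrA ler_pdivrMr//.
  have KK : (K0 * N ^ 4)%:R^-1 ^+ 2 * (C2 * (N%:R ^+ 10 / e ^+ 2)) =
     2 * ((1 + 2 * A + 4 * B) * (N%:R ^+ 2 / e ^+ 2)) :> R.
    rewrite /C2 natrM natrX; field; rewrite !gt_eqF//; lra.
  apply: (@le_trans _ _ ((K0 * N ^ 4)%:R^-1 ^+ 2 * (C2 * (N%:R ^+ 10 / e ^+ 2)))).
    by rewrite KK ler_wpM2l//; exact: hess_remainder_le.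
  by rewrite ler_wpM2l// exprn_ge0// invr_ge0 ltW.
by move=> k; split; exact: main.
Qed.

End resolvent.

(** * Quadratic part of rank one *)

Section rank_one.
Context (R : realType) (n : nat).
Implicit Types (u v b : 'I_n -> R[i]) (c D z : R[i]).

Definition lin (N : nat) v (X : 'I_n -> 'M[R[i]]_N) : 'M[R[i]]_N := \sum_k v k *: X k.

Let combE N (x y : R[i]) (A B : 'M[R[i]]_N) i j :
  (x *: A - y *: B) i j = x * A i j - y * B i j.
Proof. by rewrite !mxE. Qed.

Let normc_comb (x y p q : R[i]) :
  normc (x * p - y * q) <= normc y * normc q + normc x * normc p.
Proof.
apply: le_trans (normcD_le _ _) _.
by rewrite normcN !ComplexField.Normc.normcM addrC.
Qed.

Let mul_shifts N (al x y : R[i]) (A : 'M[R[i]]_N) :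
  al *: ((A + x%:M) *m (A + y%:M)) =
  (al *: A) *m A + (al * (x + y)) *: A + (al * (x * y))%:M.
Proof.
rewrite mulmxDl !mulmxDr mul_scalar_mx mul_mx_scalar -scalar_mxM -scalemxAl.
rewrite !scalerDr !scalerA scale_scalar_mx mulrDr scalerDl.
by rewrite [LHS](AC (2*2) (1*(3*2)*4)).
Qed.

Let invmx_scaleM N (al : R[i]) (A B : 'M[R[i]]_N) : al != 0 ->
  A \in unitmx -> B \in unitmx ->
  invmx (al *: (A *m B)) = al^-1 *: (invmx B *m invmx A).
Proof.
move=> al0 uA uB.
have E : (al^-1 *: (invmx B *m invmx A)) *m (al *: (A *m B)) = 1%:M.
  rewrite -scalemxAl -scalemxAr scalerA mulVf// scale1r.
  by rewrite -mulmxA [invmx A *m _]mulmxA mulVmx// mul1mx mulVmx.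
have [_ uP] := mulmx1_unit E.
by rewrite -[RHS]mulmx1 -(mulmxV uP) mulmxA E mul1mx.
Qed.

Let det_scaleM N (al : R[i]) (A B : 'M[R[i]]_N) :
  \det (al *: (A *m B)) != 0 -> \det A != 0 /\ \det B != 0.
Proof.
by rewrite detZ det_mulmx !mulf_eq0 !negb_or => /andP[_ /andP[]].
Qed.

Let unitmx_det N (A : 'M[R[i]]_N) : \det A != 0 -> A \in unitmx.
Proof. by rewrite unitmxE unitfE. Qed.

Let scaleE N (x : R[i]) (A : 'M[R[i]]_N) i j : (x *: A) i j = x * A i j.
Proof. by rewrite mxE. Qed.

Let subE N (A B : 'M[R[i]]_N) i j : (A - B) i j = A i j - B i j.
Proof. by rewrite !mxE. Qed.

Lemma quadmx_lin N b c (X : 'I_n -> 'M[R[i]]_N) :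
  quadmx (fun _ _ => 0) b c X = lin b X + c%:M.
Proof.
rewrite /quadmx big1 ?add0r// => i _.
by rewrite big1// => j _; rewrite scale0r.
Qed.

Lemma grad_lin N b c (X : 'I_n -> 'M[R[i]]_N) m :
  grad (fun _ _ => 0) b c X m = b m *: invmx (quadmx (fun _ _ => 0) b c X).
Proof.
rewrite /grad /qleft /qright big1; last by move=> j _; rewrite scale0r.
by rewrite mulmx0 addr0 add0r mul_scalar_mx.
Qed.

Lemma quadmx_rank1 N u v b c (X : 'I_n -> 'M[R[i]]_N) :
  quadmx (fun i j => u i * v j) b c X = lin u X *m lin v X + lin b X + c%:M.
Proof.
rewrite /quadmx /lin mulmx_suml; congr (_ + _ + _); apply: eq_bigr => i _.
by rewrite mulmx_sumr; apply: eq_bigr => j _; rewrite -scalemxAl -scalemxAr scalerA.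
Qed.

Lemma grad_rank1 N u v b c (X : 'I_n -> 'M[R[i]]_N) m :
  let G := invmx (quadmx (fun i j => u i * v j) b c X) in
  grad (fun i j => u i * v j) b c X m =
  u m *: (lin v X *m G) + b m *: G + v m *: (G *m lin u X).
Proof.
rewrite /grad /qleft /qright; set G := invmx _.
have -> : \sum_j (u m * v j) *: X j = u m *: lin v X.
  by rewrite /lin scaler_sumr; apply: eq_bigr => j _; rewrite scalerA.
have -> : \sum_i (u i * v m) *: X i = v m *: lin u X.
  by rewrite /lin scaler_sumr; apply: eq_bigr => j _; rewrite scalerA mulrC.
by rewrite mulmxDl mul_scalar_mx -scalemxAl -scalemxAr.
Qed.

(** Without a quadratic part [grad] is a scalar multiple of the inverse, so the first-order bound
    controls the inverse itself. *)
Lemma small_linear_inverse v m0 D N mu c (e : R) : v m0 = 1 -> D != 0 -> (0 < N)%N ->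
  product_law (@gauss R) mu -> 0 < e ->
  small mu [set w | \det (lin (fun k => D * v k) (@gmx R n N w) + c%:M) != 0 /\
    exists i j, Num.sqrt N%:R / e / normc D <
      normc (invmx (lin (fun k => D * v k) (gmx w) + c%:M) i j)]
   (16 * n%:R * N%:R ^+ 3 * e).
Proof.
move=> v0 D0 N0 mu_prod e0.
have nD : 0 < normc D.
  rewrite lt_def normc_ge0 andbT; apply: contra D0 => /eqP/ComplexField.Normc.eq0_normc ->.
  by rewrite eqxx.
apply: small_sub (small_derivatives N0 (fun _ _ => 0) (fun k => D * v k) c mu_prod e0).
move=> w [/= det0 [i [j h]]]; split; first by rewrite quadmx_lin.
move=> H; have [g _] := H m0 i j; move: g.
rewrite grad_lin v0 mulr1 scaleE ComplexField.Normc.normcM quadmx_lin.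
by apply/negP; rewrite -ltNge [ltRHS]mulrC -ltr_pdivrMr.
Qed.

(* The combination that eliminates the term [G *m lin u X] of [grad_rank1]. *)
Lemma combine_grad N u v b c (X : 'I_n -> 'M[R[i]]_N) m m' :
  let a := fun i j => u i * v j in
  let G := invmx (quadmx a b c X) in
  v m' *: grad a b c X m - v m *: grad a b c X m' =
  (lin (fun k => (u m * v m' - u m' * v m) * v k) X
     + (v m' * b m - v m * b m')%:M) *m G.
Proof.
move=> a G; rewrite !grad_rank1 -/G mulmxDl mul_scalar_mx.
have -> : lin (fun k => (u m * v m' - u m' * v m) * v k) X =
    (u m * v m' - u m' * v m) *: lin v X.
  by rewrite /lin scaler_sumr; apply: eq_bigr => j _; rewrite scalerA.
rewrite -scalemxAl !scalerDr !scalerBl !scalerA.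
rewrite [u m * v m']mulrC [u m' * v m]mulrC [v m * v m']mulrC !opprD.
move: ((v m' * u m) *: _) ((v m * u m') *: _) ((v m' * b m) *: _) ((v m * b m') *: _)
  ((v m' * v m) *: _) => p q r s t.
rewrite [LHS](AC (3*3) (1*4*(2*5)*(3*6))) /=.
by rewrite subrr addr0.
Qed.

Let pbound (k : R) (N : nat) (e C : R) : (0 < N)%N -> 0 < e -> 0 <= k -> k <= C ->
  k * N%:R ^+ 3 * e <= C * (N%:R ^+ 4 * e + expR (- N%:R)).
Proof.
move=> N0 e0 k0 kC; have N1 : 1 <= N%:R :> R by rewrite ler1n.
have e34 : N%:R ^+ 3 * e <= N%:R ^+ 4 * e by rewrite ler_wpM2r ?ler_weXn2l// ltW.
have y0 : 0 <= expR (- N%:R) :> R by exact: expR_ge0.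
have x0 : 0 <= N%:R ^+ 3 * e by rewrite mulr_ge0 ?exprn_ge0// ltW.
rewrite -mulrA ler_pM//; lra.
Qed.

Let sqrtN_le (N : nat) : (0 < N)%N -> Num.sqrt N%:R <= N%:R :> R.
Proof.
move=> N0; have N1 : 1 <= N%:R :> R by rewrite ler1n.
by rewrite -[leRHS]ger0_norm// -sqrtr_sqr ler_sqrt ?sqr_ge0//; nra.
Qed.

Let le_mul_sqr (x y : R) : 1 <= x -> 1 <= y -> x <= y * x ^+ 2.
Proof.
move=> x1 y1; apply: (@le_trans _ _ (x ^+ 2)); first by rewrite expr2 ler_peMl//; lra.
by rewrite ler_peMl ?sqr_ge0.
Qed.

Let threshold (N : nat) (e k C : R) : (0 < N)%N -> 0 < e -> e <= 1 -> 0 <= k -> k <= C ->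
  k * (N%:R * (N%:R / e) ^+ 2) <= C * N%:R ^+ 10 / e ^+ 2.
Proof.
move=> N0 e0 e1 k0 kC; have N1 : 1 <= N%:R :> R by rewrite ler1n.
rewrite [leLHS](_ : _ = k * N%:R ^+ 3 / e ^+ 2); last by field; rewrite gt_eqF.
rewrite ler_wpM2r ?invr_ge0 ?exprn_ge0 ?(ltW e0)// ler_pM ?exprn_ge0//.
by rewrite ler_weXn2l.
Qed.

Variables (u v : 'I_n -> R[i]) (b : 'I_n -> R[i]) (m0 : 'I_n).
Hypothesis v_m0 : v m0 = 1.

Let a i j := u i * v j.

Let nD_gt0 D : D != 0 -> 0 < normc D.
Proof.
move=> D0; rewrite lt_def normc_ge0 andbT.
by apply: contra D0 => /eqP/ComplexField.Normc.eq0_normc ->; rewrite eqxx.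
Qed.

(* Here [combine_grad] gives a scalar multiple of [G]. *)
Lemma resolvent_tail_linear m m' :
  u m * v m' - u m' * v m = 0 -> v m' * b m - v m * b m' != 0 ->
  exists2 C : R, 0 < C & resolvent_tail a b C.
Proof.
move=> D0 d0; set d := _ - _ in d0; have nd := nD_gt0 d0.
pose V := normc (v m) + normc (v m').
have V0 : 0 <= V by rewrite addr_ge0 ?normc_ge0.
exists (16 * n%:R + V / normc d + 1).
  have := divr_ge0 V0 (ltW nd); have : 0 <= n%:R :> R by []. lra.
have Vd := divr_ge0 V0 (ltW nd); have n0 : 0 <= n%:R :> R by [].
move=> N N0 mu mu_prod c e e0 e1; have N1 : 1 <= N%:R :> R by rewrite ler1n.
apply: small_le (small_sub _ (small_derivatives N0 a b c mu_prod e0)).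
  by apply: pbound => //; lra.
move=> w [det0 [i [j h]]]; split => // H; move: h; apply/negP; rewrite -leNgt.
set G := invmx _.
have : d * G i j = v m' * grad a b c (gmx w) m i j - v m * grad a b c (gmx w) m' i j.
  have /= := combine_grad u v b c (gmx w) m m'.
  rewrite D0 -/d.
  have -> : lin (fun k => 0 * v k) (gmx w) = 0.
    by rewrite /lin big1// => k _; rewrite mul0r scale0r.
  rewrite add0r mul_scalar_mx => /matrixP/(_ i j).
  by rewrite combE scaleE => <-.
move=> /(congr1 (@normc R)); rewrite ComplexField.Normc.normcM => E.
have : normc d * normc (G i j) <= V * (Num.sqrt N%:R / e).
  rewrite E; apply: le_trans (normc_comb _ _ _ _) _.
  rewrite /V mulrDl; apply: lerD; apply: ler_wpM2l; rewrite ?normc_ge0//.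
    by have [] := H m' i j.
  by have [] := H m i j.
rewrite mulrC -ler_pdivlMr// => h; apply: le_trans h _.
have kC : V / normc d <= 16 * n%:R + V / normc d + 1 by lra.
apply: le_trans (threshold N0 e0 e1 Vd kC).
rewrite mulrAC ler_wpM2l//.
have Ne : 1 <= N%:R / e by rewrite ler_pdivlMr// mul1r; lra.
apply: (@le_trans _ _ (N%:R / e)); first by rewrite ler_wpM2r ?invr_ge0 ?(ltW e0)// sqrtN_le.
exact: le_mul_sqr.
Qed.

(* Here [combine_grad] gives [L *m G] with [L] an affine form in the Gaussian
   matrices, whose inverse is again controlled by logarithmic derivatives. *)
Lemma resolvent_tail_product m m' : u m * v m' - u m' * v m != 0 ->
  exists2 C : R, 0 < C & resolvent_tail a b C.
Proof.
move=> D0; set D := _ - _ in D0; have nD := nD_gt0 D0.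
pose V := normc (v m) + normc (v m').
have V0 : 0 <= V by rewrite addr_ge0 ?normc_ge0.
have n0 : 0 <= n%:R :> R by [].
have Vd : 0 <= 2 * V / normc D by rewrite divr_ge0 ?mulr_ge0// ltW.
pose C := 32 * n%:R + 1 + 2 * V / normc D.
have kC : 2 * V / normc D <= C by rewrite /C; lra.
exists C; first by rewrite /C; lra.
move=> N N0 mu mu_prod c e e0 e1; have N1 : 1 <= N%:R :> R by rewrite ler1n.
pose k1 := Num.sqrt N%:R / e.
have k10 : 0 < k1 by rewrite divr_gt0// sqrtr_gt0 ltr0n.
pose b' := v m' * b m - v m * b m'.
pose Lin (w : array R (gcoord n N)) := lin (fun k => D * v k) (gmx w) + b'%:M.
have mLin : mmeas Lin.
  apply: mmeasD; last exact: mmeas_cst.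
  by apply: mmeas_sum => k; apply: mmeasZ; exact: mmeas_gmx.
(* [Lin w] may be singular, so a shift of it by [l <= l0] is inverted instead. The error [l *: G]
   then contributes at most [N (k1 / |D|) l gam <= gam / 2] to the largest entry [gam] of [G] and is
   absorbed on the left. *)
pose l0 := normc D / (2 * N%:R * k1).
have Npos : 0 < N%:R :> R by rewrite ltr0n.
have l00 : 0 < l0 by rewrite divr_gt0// mulr_gt0// mulr_gt0.
have [l /andP[lgt0 ll0] Sl] := exists_generic_shift mu mLin e0 l00.
have S1 := small_derivatives N0 a b c mu_prod e0.
have S2 := small_linear_inverse (b' - l%:C) v_m0 D0 N0 mu_prod e0.
apply: small_le (small_sub _ (smallU S1 (smallU S2 Sl))).
  have h : (32 * n%:R + 1) * N%:R ^+ 3 * e <= C * (N%:R ^+ 4 * e + expR (- N%:R)).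
    by apply: pbound => //; rewrite /C; lra.
  apply: le_trans h.
  have e3 : e <= N%:R ^+ 3 * e by rewrite ler_peMl ?exprn_ege1// ltW.
  rewrite [leRHS](_ : _ = 16 * n%:R * N%:R ^+ 3 * e + 16 * n%:R * N%:R ^+ 3 * e
    + N%:R ^+ 3 * e); last by ring.
  by lra.
move=> w [det0 [i [j h]]]; apply: contrapT => /not_orP[H1 /not_orP[H2 H3]].
have {H1} H : forall m i j, normc (grad a b c (gmx w) m i j) <= k1.
  move=> m1 i1 j1; apply: contrapT => hh; apply: H1; split => // HH.
  by apply: hh; have [] := HH m1 i1 j1.
pose Ll := lin (fun k => D * v k) (gmx w) + (b' - l%:C)%:M.
have LE : Lin w = Ll + l%:C%:M.
  by rewrite /Lin /Ll -addrA -raddfD /= subrK.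
have detL : \det Ll != 0.
  apply/eqP => dL; apply: H3; rewrite /= -dL LE; congr (\det _).
  by rewrite addrK.
have {H2} HL i1 j1 : normc (invmx Ll i1 j1) <= k1 / normc D.
  apply: contrapT => /negP; rewrite -ltNge => hh; apply: H2; split => //.
  by exists i1, j1.
move: h; apply/negP; rewrite -leNgt; set G := invmx _.
have [i0 [j0 Gmax]] := exists_max_entry G N0.
apply: le_trans (Gmax i j) _; set gam := normc (G i0 j0).
have gam0 : 0 <= gam by exact: normc_ge0.
pose K' := v m' *: grad a b c (gmx w) m - v m *: grad a b c (gmx w) m' - l%:C *: G.
have uL : Ll \in unitmx by rewrite unitmxE unitfE.
have GE : G = invmx Ll *m K'.
  rewrite /K' combine_grad -/D -/b' -/(Lin w) LE mulmxDl mul_scalar_mx.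
  by rewrite addrK mulmxA mulVmx// mul1mx.
have K'le p q : normc (K' p q) <= V * k1 + l * gam.
  have -> : K' p q = v m' * grad a b c (gmx w) m p q
      - v m * grad a b c (gmx w) m' p q - l%:C * G p q.
    by rewrite subE combE scaleE.
  apply: le_trans (normcD_le _ _) _; rewrite normcN; apply: lerD.
    apply: le_trans (normc_comb _ _ _ _) _.
    by rewrite /V mulrDl; apply: lerD; apply: ler_wpM2l; rewrite ?normc_ge0.
  rewrite ComplexField.Normc.normcM normc_real (gtr0_norm lgt0).
  by apply: ler_wpM2l; rewrite ?(ltW lgt0).
have gle : gam <= N%:R * (k1 / normc D * (V * k1 + l * gam)).
  rewrite {1}/gam {1}GE; apply: normc_mulmx => //.
  by rewrite divr_ge0 ?ltW.
have lk : N%:R * (k1 / normc D * (l * gam)) <= gam / 2.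
  apply: (@le_trans _ _ (N%:R * (k1 / normc D * (l0 * gam)))).
    apply: ler_wpM2l => //; apply: ler_wpM2l; last exact: ler_wpM2r.
    by rewrite divr_ge0 ?(ltW k10) ?(ltW nD).
  by rewrite /l0 le_eqVlt; apply/orP; left; apply/eqP; field; rewrite !gt_eqF//; lra.
have {gle lk} gle : gam <= 2 * V / normc D * (N%:R * k1 ^+ 2).
  rewrite [leRHS](_ : _ = 2 * (N%:R * (k1 / normc D * (V * k1)))); last by ring.
  by move: gle; rewrite !mulrDr; lra.
apply: le_trans gle _; apply: le_trans (threshold N0 e0 e1 Vd kC).
rewrite ler_wpM2l// ler_wpM2l// lerXn2r ?nnegrE ?(ltW k10) ?divr_ge0 ?(ltW e0)//.
by rewrite ler_wpM2r ?invr_ge0 ?(ltW e0)// sqrtN_le.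
Qed.

(** The matrix is a one-variable quadratic in the single form [L = lin v X], hence
    [al (L - z1)(L - z2)]. The roots depend on [c], but the bound of [small_linear_inverse] on each
    factor does not. *)
Lemma resolvent_tail_square al be : al != 0 ->
  (forall k, u k = al * v k) -> (forall k, b k = be * v k) ->
  exists2 C : R, 0 < C & resolvent_tail a b C.
Proof.
move=> al0 uE bE; have nal := nD_gt0 al0.
have n0 : 0 <= n%:R :> R by [].
have Vd : 0 <= (normc al)^-1 by rewrite invr_ge0 ltW.
pose C := 32 * n%:R + 1 + (normc al)^-1.
have kC : (normc al)^-1 <= C by rewrite /C; lra.
exists C; first by rewrite /C; lra.
move=> N N0 mu mu_prod c e e0 e1; have N1 : 1 <= N%:R :> R by rewrite ler1n.
pose D := sqrtC (be ^+ 2 - 4 * al * c).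
pose z1 := (- be + D) / (2 * al); pose z2 := (- be - D) / (2 * al).
have DD : D ^+ 2 = be ^+ 2 - 4 * al * c by rewrite sqrtCK.
have zS : be = al * (- z1 - z2) by rewrite /z1 /z2; field.
have zP : c = al * (z1 * z2).
  have -> : c = (be ^+ 2 - D ^+ 2) / (4 * al) by rewrite DD; field.
  by rewrite /z1 /z2; field.
have ME w : quadmx a b c (@gmx R n N w) =
    al *: ((lin (fun k => 1 * v k) (gmx w) + (- z1)%:M) *m
      (lin (fun k => 1 * v k) (gmx w) + (- z2)%:M)).
  rewrite quadmx_rank1.
  have -> : lin u (gmx w) = al *: lin v (gmx w).
    by rewrite /lin scaler_sumr; apply: eq_bigr => k _; rewrite uE scalerA.
  have -> : lin b (gmx w) = be *: lin v (gmx w).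
    by rewrite /lin scaler_sumr; apply: eq_bigr => k _; rewrite bE scalerA.
  have -> : lin (fun k => 1 * v k) (gmx w) = lin v (gmx w).
    by apply: eq_bigr => k _; rewrite mul1r.
  by rewrite mul_shifts mulrNN -zS -zP.
have S1 := small_linear_inverse (- z1) v_m0 (oner_neq0 _) N0 mu_prod e0.
have S2 := small_linear_inverse (- z2) v_m0 (oner_neq0 _) N0 mu_prod e0.
apply: small_le (small_sub _ (smallU S1 S2)).
  have h : (32 * n%:R) * N%:R ^+ 3 * e <= C * (N%:R ^+ 4 * e + expR (- N%:R)).
    by apply: pbound => //; rewrite /C; lra.
  by apply: le_trans h; lra.
move=> w [det0 [i [j h]]]; apply: contrapT => /not_orP[H1 H2].
move: det0 h; rewrite ME.
set L1 := _ + (- z1)%:M in H1 *; set L2 := _ + (- z2)%:M in H2 *.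
move=> /det_scaleM[d1 d2].
have u1 := unitmx_det d1; have u2 := unitmx_det d2.
have HL1 i1 j1 : normc (invmx L1 i1 j1) <= Num.sqrt N%:R / e.
  apply: contrapT => /negP; rewrite -ltNge => hh; apply: H1.
  by split; [exact: d1|exists i1, j1; rewrite ComplexField.Normc.normc1 divr1].
have HL2 i1 j1 : normc (invmx L2 i1 j1) <= Num.sqrt N%:R / e.
  apply: contrapT => /negP; rewrite -ltNge => hh; apply: H2.
  by split; [exact: d2|exists i1, j1; rewrite ComplexField.Normc.normc1 divr1].
rewrite invmx_scaleM//.
apply/negP; rewrite -leNgt scaleE ComplexField.Normc.normcM ComplexField.Normc.normcV.
apply: le_trans (threshold N0 e0 e1 Vd kC).
rewrite ler_wpM2l//.
have k0 : 0 <= Num.sqrt N%:R / e by rewrite divr_ge0 ?sqrtr_ge0 ?(ltW e0).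
apply: le_trans (@normc_mulmx R _ _ _ _ _ _ _ i j k0 (HL2 i) (HL1^~ j)) _.
have kN : Num.sqrt N%:R / e <= N%:R / e by rewrite ler_wpM2r ?invr_ge0 ?(ltW e0)// sqrtN_le.
by rewrite ler_wpM2l// expr2 ler_pM.
Qed.

End rank_one.

Lemma quadratic_resolvent_tail (R : realType) (n : nat) (a : 'I_n -> 'I_n -> R[i])
    (b : 'I_n -> R[i]) (i0 m0 : 'I_n) : a i0 m0 != 0 ->
  exists2 C : R, 0 < C & resolvent_tail a b C.
Proof.
move=> a00.
have [[i1 [i2 [m [m' D]]]]|minors0] := pselect (exists i1 i2 m m',
    a i1 m * a i2 m' - a i2 m * a i1 m' != 0).
  exact: (resolvent_tail_minor b D).
(* All minors vanish, so [a] is the outer product of its column [m0] and its row [i0], the latter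
   normalised to have entry one at [m0]. *)
pose u i := a i m0; pose v j := a i0 j / a i0 m0.
have vm0 : v m0 = 1 by rewrite /v divff.
have -> : a = fun i j => u i * v j.
  apply/funext => i; apply/funext => j; rewrite /u /v.
  have /eqP : a i m0 * a i0 j - a i0 m0 * a i j == 0.
    by apply: contrapT => /negP h; apply: minors0; exists i, i0, m0, j.
  move=> /subr0_eq E; rewrite mulrA E; field; exact: a00.
have [[m [m' D]]|uv] := pselect (exists m m', u m * v m' - u m' * v m != 0).
  exact: (resolvent_tail_product b vm0 D).
have uE k : u k = u m0 * v k.
  have /eqP : u k * v m0 - u m0 * v k == 0.
    by apply: contrapT => /negP h; apply: uv; exists k, m0.
  by move=> /subr0_eq; rewrite vm0 mulr1.
have um0 : u m0 != 0.
  by apply: contraNneq a00 => h; rewrite -/(u i0) uE h mul0r.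
(* Now [u] is a multiple of [v]. Either [b] is not parallel to [v] and the gradients isolate [G], or
   the whole polynomial depends on one linear form. *)
have [[m [m' D]]|vb] := pselect (exists m m', v m' * b m - v m * b m' != 0).
  apply: (resolvent_tail_linear _ D).
  by apply/eqP; apply: contrapT => /negP h; apply: uv; exists m, m'.
apply: (resolvent_tail_square vm0 um0 uE (be := b m0)) => k.
have /eqP : v m0 * b k - v k * b m0 == 0.
  by apply: contrapT => /negP h; apply: vb; exists k, m0.
by move=> /subr0_eq; rewrite vm0 mul1r mulrC.
Qed.

(** * The smallest singular value *)

Section smallest_singular_value.
Context (R : realType) (N : nat).
Implicit Types (A G : 'M[R[i]]_N) (v : 'rV[R[i]]_N).

Lemma mulC_conj (x : R[i]) : x * Num.conj x = (normc x ^+ 2)%:C.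
Proof. by rewrite -normCK rmorphXn /=; congr (_ ^+ 2). Qed.

Lemma normc_conj (x : R[i]) : normc (Num.conj x) = normc x.
Proof. by apply: complexI; exact: (norm_conjC x). Qed.

Let sqn v : R := \sum_j normc (v 0 j) ^+ 2.

Let sqnE v : (v *m map_mx Num.conj v^T) 0 0 = (sqn v)%:C.
Proof.
rewrite mxE rmorph_sum /=; apply: eq_bigr => j _.
by rewrite !mxE mulC_conj.
Qed.

Let sqn_gt0 v : v != 0 -> 0 < sqn v.
Proof.
move=> v0; rewrite lt_def sumr_ge0 ?andbT; last by move=> j _; exact: sqr_ge0.
apply: contra v0; rewrite psumr_eq0; last by move=> j _; exact: sqr_ge0.
move=> /allP H; apply/eqP/rowP => j; rewrite mxE.
have := H j (mem_index_enum j); rewrite sqrf_eq0 => /eqP.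
exact: ComplexField.Normc.eq0_normc.
Qed.

Let gram A := map_mx Num.conj A^T *m A.

(** The left side is [v A* A v*], and [v] is a left eigenvector of [A* A], the convention of
    [eigenvalue]. *)
Lemma eigenvalue_gram A (l : R[i]) v : v *m gram A = l *: v ->
  (\sum_j normc ((v *m map_mx Num.conj A^T) 0 j) ^+ 2)%:C =
  l * (\sum_j normc (v 0 j) ^+ 2)%:C.
Proof.
move=> vl; rewrite -!sqnE trmx_mul map_mxM /=.
rewrite -[map_mx _ (map_mx _ _)^T]/(map_mx Num.conj (map_mx Num.conj A^T)^T).
have -> : map_mx Num.conj (map_mx Num.conj A^T)^T = A.
  by apply/matrixP => i j; rewrite !mxE conjCK.
rewrite mulmxA -[v *m _ *m A]mulmxA vl -scalemxAl.
by rewrite mxE.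
Qed.

Lemma eigenvalue_gram_ge0 A (l : R[i]) :
  eigenvalue (map_mx Num.conj A^T *m A) l -> exists2 r : R, 0 <= r & l = r%:C.
Proof.
move=> /eigenvalueP[v vl v0]; have := eigenvalue_gram vl.
set S := \sum_j _; set s := \sum_j _; have s0 : 0 < s by exact: sqn_gt0.
have S0 : 0 <= S by apply: sumr_ge0 => j _; exact: sqr_ge0.
have sC : s%:C != 0 by rewrite -(rmorph0 (real_complex R)) (inj_eq (@complexI R)) gt_eqF.
move=> E; exists (S / s); first by rewrite divr_ge0// ltW.
by rewrite rmorphM fmorphV /= E mulfK.
Qed.

(** The characteristic polynomial of [A* A] splits over [R[i]] with nonnegative real roots, and the
    square root of the smallest one attains the infimum. *)
Lemma sigma_minP A : (0 < N)%N -> singular_value A (sigma_min A) /\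
  forall r : R, 0 <= r -> eigenvalue (map_mx Num.conj A^T *m A) r%:C -> sigma_min A ^+ 2 <= r.
Proof.
move=> N0; set H := map_mx _ _ *m A.
have [rs rsE] := closed_field_poly_normal (char_poly H).
rewrite (monicP (char_poly_monic H)) scale1r in rsE.
have rsP l : (l \in rs) = eigenvalue H l.
  by rewrite eigenvalue_root_char rsE root_prod_XsubC.
have size_rs : size rs = N.
  by apply/eqP; rewrite -eqSS -(size_char_poly H) rsE size_prod_XsubC.
have rs_ge0 l : l \in rs -> exists2 r : R, 0 <= r & l = r%:C.
  by rewrite rsP => /eigenvalue_gram_ge0.
have i00 : (0 < size rs)%N by rewrite size_rs.
have := @arg_minP _ _ _ (Ordinal i00) xpredT
  (fun i : 'I_(size rs) => complex.Re (rs`_i)) isT.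
case=> i1 _ imin.
have [r1 r10 r1E] : exists2 r : R, 0 <= r & rs`_i1 = r%:C by apply: rs_ge0; exact: mem_nth.
have r1min r : eigenvalue H r%:C -> r1 <= r.
  rewrite -rsP => /(nthP 0)[k ksz kE].
  by have := imin (Ordinal ksz) isT; rewrite r1E /= kE.
have s1 : singular_value A (Num.sqrt r1).
  by split; [exact: sqrtr_ge0|rewrite sqr_sqrtr// -r1E -/H -rsP mem_nth].
have -> : sigma_min A = Num.sqrt r1.
  apply/eqP; rewrite eq_le; apply/andP; split.
    by apply: ge_inf => //; exists 0 => s [].
  apply: lb_le_inf; first by exists (Num.sqrt r1).
  move=> s [s0 sl]; rewrite -[s]ger0_norm// -sqrtr_sqr ler_sqrt ?sqr_ge0//.
  exact: r1min.
by split => // r r0 rl; rewrite sqr_sqrtr//; exact: r1min.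
Qed.

(** A left eigenvector [v] of [A* A] for the smallest eigenvalue has [v A*] of norm at most [eps]
    times its own, and shifting by [z] adds at most [eps]. Recovering [v] by applying the adjoint of
    the inverse, and comparing at the largest entry of [v], costs a factor of at most
    [N (N + 1) g]. *)
Lemma resolvent_lower_bound A (z : R[i]) (eps g : R) : (0 < N)%N -> 0 <= eps ->
  0 <= g -> sigma_min A <= eps -> normc z <= eps -> A - z%:M \in unitmx ->
  (forall i j, normc (invmx (A - z%:M) i j) <= g) ->
  1 <= 2 * N%:R ^+ 2 * eps * g.
Proof.
move=> N0 eps0 g0 sA zeps uA gG; have [[s0 sE] _] := sigma_minP A N0.
set s := sigma_min A in sA s0 sE; have /eigenvalueP[v vl v0] := sE.
pose u := v *m map_mx Num.conj A^T.
have uv : sqn u = s ^+ 2 * sqn v.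
  by apply: complexI; rewrite rmorphM /=; exact: eigenvalue_gram vl.
have [i' [j0 vmax0]] := exists_max_entry (\matrix_(i < N, j < N) v 0 j) N0.
have vmax j : normc (v 0 j) <= normc (v 0 j0).
  by have := vmax0 (Ordinal N0) j; rewrite !mxE.
set M := normc (v 0 j0) in vmax.
have N1 : 1 <= N%:R :> R by rewrite ler1n.
have M0 : 0 < M.
  rewrite lt_def normc_ge0 andbT; apply: contra v0 => /eqP M0.
  apply/eqP/rowP => j; rewrite mxE; apply: ComplexField.Normc.eq0_normc.
  by apply/eqP; rewrite eq_le normc_ge0 -M0 vmax.
have uk k : normc (u 0 k) <= N%:R * (eps * M).
  rewrite -(@ler_pXn2r _ 2)// ?nnegrE ?normc_ge0 ?mulr_ge0// ?(ltW M0)//.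
  apply: (@le_trans _ _ (sqn u)).
    by rewrite /sqn (bigD1 k)//= lerDl sumr_ge0// => j _; exact: sqr_ge0.
  rewrite uv; apply: (@le_trans _ _ (eps ^+ 2 * (N%:R * M ^+ 2))).
    rewrite ler_pM ?sqr_ge0 ?sumr_ge0//; first by move=> j _; exact: sqr_ge0.
      by rewrite lerXn2r.
    rewrite /sqn [leRHS](_ : _ = \sum_(j < N) M ^+ 2); last first.
      by rewrite sumr_const card_ord mulr_natl.
    by apply: ler_sum => j _; rewrite lerXn2r ?nnegrE ?normc_ge0 ?(ltW M0).
  rewrite !exprMn mulrCA ler_wpM2l ?sqr_ge0// ler_wpM2r ?sqr_ge0//; nra.
pose B := map_mx Num.conj (invmx (A - z%:M))^T.
have BE : map_mx Num.conj (A - z%:M)^T *m B = 1%:M.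
  by rewrite /B -map_mxM -trmx_mul mulVmx// trmx1 map_mx1.
have uz : v *m map_mx Num.conj (A - z%:M)^T = u - Num.conj z *: v.
  by rewrite linearB /= map_mxB mulmxBr tr_scalar_mx map_scalar_mx mul_mx_scalar.
have vE : v = (u - Num.conj z *: v) *m B by rewrite -uz -mulmxA BE mulmx1.
have : M <= N%:R * ((N%:R * (eps * M) + eps * M) * g).
  rewrite /M {1}vE; apply: normc_mulmx.
  - by rewrite addr_ge0 ?mulr_ge0 ?(ltW M0).
  - have entryE (p q : 'rV[R[i]]_N) x k : (p - x *: q) 0 k = p 0 k - x * q 0 k.
      by rewrite !mxE.
    move=> j; rewrite entryE; apply: le_trans (normcD_le _ _) _; rewrite normcN.
    rewrite ComplexField.Normc.normcM normc_conj; apply: lerD; first exact: uk.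
    by rewrite ler_pM ?normc_ge0.
  - by move=> j; rewrite !mxE normc_conj.
move=> h; rewrite -(@ler_pM2r _ M)// mul1r; apply: le_trans h _.
have eg : 0 <= eps * g * M by rewrite !mulr_ge0// ltW.
rewrite [leLHS](_ : _ = (N%:R ^+ 2 + N%:R) * (eps * g * M)); last by ring.
rewrite [leRHS](_ : _ = (2 * N%:R ^+ 2) * (eps * g * M)); last by ring.
by rewrite ler_wpM2r//; nra.
Qed.

End smallest_singular_value.

(** * Measurability of the coefficients of the characteristic polynomial *)

Section polynomial_measurability.
Context (R : realType) d (T : measurableType d).
Implicit Types p q : T -> {poly R[i]}.

Definition pmeas p := forall k, cmeas (fun t => (p t)`_k).

Lemma pmeas_ext p q : p =1 q -> pmeas p -> pmeas q.
Proof. by move=> /funext ->. Qed.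

Lemma pmeas_cst (r : {poly R[i]}) : pmeas (fun=> r).
Proof. by move=> k; exact: cmeas_cst. Qed.

Lemma pmeasD p q : pmeas p -> pmeas q -> pmeas (fun t => p t + q t).
Proof.
by move=> mp mq k; apply: cmeas_ext (cmeasD (mp k) (mq k)) => t; rewrite coefD.
Qed.

Lemma pmeasM p q : pmeas p -> pmeas q -> pmeas (fun t => p t * q t).
Proof.
move=> mp mq k.
apply: cmeas_ext (cmeas_sum (index_enum _) xpredT
  (fun j : 'I_k.+1 => cmeasM (mp j) (mq (k - j)%N))) => t.
by rewrite coefM.
Qed.

Lemma pmeas_sum (I : Type) (s : seq I) (F : I -> T -> {poly R[i]}) :
  (forall i, pmeas (F i)) -> pmeas (fun t => \sum_(i <- s) F i t).
Proof.
move=> mF; elim: s => [|i s IH].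
  by apply: pmeas_ext (pmeas_cst 0) => t; rewrite big_nil.
by apply: pmeas_ext (pmeasD (mF i) IH) => t; rewrite big_cons.
Qed.

Lemma pmeas_prod (I : Type) (s : seq I) (F : I -> T -> {poly R[i]}) :
  (forall i, pmeas (F i)) -> pmeas (fun t => \prod_(i <- s) F i t).
Proof.
move=> mF; elim: s => [|i s IH].
  by apply: pmeas_ext (pmeas_cst 1) => t; rewrite big_nil.
by apply: pmeas_ext (pmeasM (mF i) IH) => t; rewrite big_cons.
Qed.

Lemma pmeas_char_poly N (A : T -> 'M[R[i]]_N) : mmeas A ->
  pmeas (fun t => char_poly (A t)).
Proof.
move=> mA; rewrite /char_poly /determinant; apply: pmeas_sum => s.
apply: pmeasM; first exact: pmeas_cst.
apply: pmeas_prod => i k.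
have mk := cmeasB (cmeas_cst T (('X *+ (i == s i)) : {poly R[i]})`_k)
  (cmeasM (mA i (s i)) (cmeas_cst T (k == 0%N)%:R)).
apply: cmeas_ext mk => t.
by rewrite !mxE coefB coefC; case: (k == 0%N); rewrite ?mulr1 ?mulr0.
Qed.

End polynomial_measurability.

(** * Measurability of the smallest singular value *)

Section sigma_min_measurability.
Context (R : realType) (N : nat).
Hypothesis N_gt0 : (0 < N)%N.

Lemma coef_prod_XsubC_gt0 (s : seq R[i]) :
  (forall x, x \in s -> exists2 r : R, 0 < r & x = - r%:C) ->
  forall k, (k <= size s)%N ->
    exists2 r : R, 0 < r & (\prod_(x <- s) ('X - x%:P))`_k = r%:C.
Proof.
elim: s => [_ [|//] _|x s IH xs k].
  by exists 1; rewrite ?ltr01// big_nil coef1.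
have [r r0 ->] := xs x (mem_head _ _).
have {}IH := IH (fun y ys => xs y (mem_behead (s := x :: s) ys)).
rewrite big_cons polyCN opprK mulrDl coefD coefCM coefXM.
case: k => [_|k /= ks].
  have [r' r'0 ->] := IH 0%N isT.
  by exists (r * r'); [exact: mulr_gt0|rewrite add0r rmorphM].
have [r1 r10 ->] := IH k ks.
move: ks; rewrite ltnS leq_eqVlt => /predU1P[ks|ks].
  exists r1 => //; rewrite nth_default ?mulr0 ?addr0//.
  by rewrite size_prod_XsubC ks.
have [r2 r20 ->] := IH k.+1 ks.
by exists (r1 + r * r2); rewrite ?addr_gt0 ?mulr_gt0// rmorphD rmorphM.
Qed.

Let gap (A : 'M[R[i]]_N) (eps : R) : 'M[R[i]]_N :=
  (eps ^+ 2)%:C%:M - map_mx Num.conj A^T *m A.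

(* The roots of the polynomial are [eps ^ 2 - s ^ 2] with [s] singular, so
   they are all negative if and only if its coefficients are positive. *)
Lemma sigma_min_gtP (A : 'M[R[i]]_N) (eps : R) : 0 < eps ->
  eps < sigma_min A <-> forall k : 'I_N.+1,
    0 < complex.Re (char_poly ((eps ^+ 2)%:C%:M - map_mx Num.conj A^T *m A))`_k.
Proof.
move=> eps0; rewrite -/(gap A eps).
have gapE x : eigenvalue (gap A eps) x =
    eigenvalue (map_mx Num.conj A^T *m A) ((eps ^+ 2)%:C - x).
  apply/eigenvalueP/eigenvalueP => -[v vx v0]; exists v => //; move: vx.
    rewrite /gap mulmxBr mul_mx_scalar => /eqP; rewrite subr_eq addrC -subr_eq.
    by move=> /eqP <-; rewrite scalerBl.
  by move=> vx; rewrite /gap mulmxBr mul_mx_scalar vx scalerBl opprB addrC subrK.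
have [[s0 sE] smin] := sigma_minP A N_gt0.
split => [epss k|pos].
  have [rs rsE] := closed_field_poly_normal (char_poly (gap A eps)).
  rewrite (monicP (char_poly_monic _)) scale1r in rsE.
  have size_rs : size rs = N.
    by apply/eqP; rewrite -eqSS -(size_char_poly (gap A eps)) rsE size_prod_XsubC.
  rewrite rsE; have [||r r0 -> //] := @coef_prod_XsubC_gt0 rs _ k _; last first.
    by rewrite size_rs -ltnS.
  move=> x; rewrite -root_prod_XsubC -rsE -eigenvalue_root_char gapE => xE.
  have [r r0 rE] := eigenvalue_gram_ge0 xE.
  exists (r - eps ^+ 2); last by rewrite rmorphB /= -rE; ring.
  rewrite subr_gt0; apply: (@lt_le_trans _ _ (sigma_min A ^+ 2)).
    by rewrite ltr_pXn2r// nnegrE// ltW.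
  by apply: (smin _ r0); rewrite -rE.
rewrite ltNge; apply/negP => seps.
(* This nonnegative [x] would be a root, whereas nonnegative powers weighted by positive
   coefficients, with a positive constant term, have a positive sum. *)
pose x := eps ^+ 2 - sigma_min A ^+ 2.
have x0 : 0 <= x by rewrite subr_ge0 lerXn2r// nnegrE// ltW.
have : eigenvalue (gap A eps) x%:C.
  by rewrite gapE (_ : _ - _ = (sigma_min A ^+ 2)%:C)// /x rmorphB /=; ring.
rewrite eigenvalue_root_char => /rootP; rewrite horner_coef => H.
have {H} : complex.Re (\sum_(i < size (char_poly (gap A eps)))
   (char_poly (gap A eps))`_i * x%:C ^+ i) = 0 by rewrite H.
apply/eqP; rewrite gt_eqF// size_char_poly raddf_sum /= big_ord_recl /=.
have ReM (z : R[i]) (r : R) i : complex.Re (z * r%:C ^+ i) = complex.Re z * r ^+ i.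
  by rewrite -rmorphXn /=; case: z => p q /=; rewrite mulr0 subr0.
rewrite ReM expr0 mulr1 ltr_pwDl ?(pos ord0)// sumr_ge0// => i _.
by rewrite ReM mulr_ge0 ?exprn_ge0// ltW// (pos (lift ord0 i)).
Qed.

Lemma measurable_sigma_min_le d (T : measurableType d) (A : T -> 'M[R[i]]_N)
    (eps : R) : 0 < eps -> mmeas A -> measurable [set t | sigma_min (A t) <= eps].
Proof.
move=> eps0 mA.
rewrite (_ : [set _ | _] = ~` \bigcap_(k in [set: 'I_N.+1])
   [set t | 0 < complex.Re (char_poly (gap (A t) eps))`_k]).
  apply: measurableC; apply: fin_bigcap_measurable => // k _.
  apply: measurable_set_lt; first exact: measurable_cst.
  apply: (pmeas_char_poly _ k).1; apply: mmeasB; first exact: mmeas_cst.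
  apply: mmeasM => // i j; apply: cmeas_ext (cmeas_conj (mA j i)) => t.
  by rewrite !mxE.
apply/seteqP; split => t /=; rewrite leNgt.
  by move=> /negP h H; apply: h; apply/(sigma_min_gtP _ eps0) => k; exact: H.
by move=> h; apply/negP => /(sigma_min_gtP _ eps0) H; apply: h => k _; exact: H.
Qed.

End sigma_min_measurability.

(** * Ginibre matrices and noncommutative polynomials *)

Section independent_boxes.
Context (R : realType) d (T : measurableType d) (P : probability T R).

Lemma independent_families_box (I J : finType) (f : I -> J -> T -> R)
    (B : I -> J -> set R) : (forall i j, measurable (B i j)) ->
  independent_families P f ->
  P [set t | forall i j, B i j (f i j t)] =
  (\prod_i P [set t | forall j, B i j (f i j t)])%E.
Proof.
move=> mB [_ indep].
have mE i : i \in seq_fset tt (enum I) ->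
    sigma_generated (f i) [set t | forall j, B i j (f i j t)].
  move=> _; rewrite /sigma_generated; set G := bigcup _ _.
  rewrite (_ : [set _ | _] = \bigcap_(j in [set: J]) (f i j @^-1` B i j)).
    apply: (@fin_bigcap_measurable _ (g_sigma_algebraType G)) => // j _.
    apply: sub_sigma_algebra; exists j => //; exists (B i j) => //.
    by rewrite setTI.
  by apply/seteqP; split => t /= H j; [move=> _; exact: H|exact: H].
have := indep _ _ mE.
rewrite (perm_big _ (seq_fset_perm tt _)) (perm_big (index_enum I)) /=; last first.
  by rewrite undup_id ?enum_uniq// enumT.
move=> <-; congr (P _); apply/seteqP; split => t /= H i; first by move=> _; exact: H.
by apply: H; change (i \in seq_fset tt (enum I)); rewrite seq_fsetE mem_enum.
Qed.

Lemma iid_normal_box (I : finType) (f : I -> T -> R) (m s : R) (B : I -> set R) :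
  (forall i, measurable (B i)) -> iid_normal P f m s ->
  P [set t | forall i, B i (f i t)] = (\prod_i normal_prob m s (B i))%E.
Proof.
move=> mB [_ indep law].
have := independent_families_box (B := fun i (_ : unit) => B i) (fun i _ => mB i) indep.
rewrite (_ : [set t | forall i, unit -> _] = [set t | forall i, B i (f i t)]); last first.
  by apply/seteqP; split => t /= H i; [exact: H|move=> _; exact: H].
move=> ->; apply: eq_bigr => i _; rewrite -(law i)//; congr (P _).
by apply/seteqP; split => t /=; [exact|move=> ? _].
Qed.

End independent_boxes.

Section ginibre_coordinates.
Context (R : realType) d (T : measurableType d) (P : probability T R) (n N : nat).
Hypothesis N_gt0 : (0 < N)%N.
Variable X : 'I_n -> T -> 'M[R[i]]_N.
Hypotheses (X_ginibre : forall k, complex_ginibre P (X k))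
  (X_indep : independent_matrices P X).

Definition ginibre_coord (t : T) : array R (gcoord n N) :=
  fun r => Num.sqrt N%:R * entry_parts (X r.1) r.2 t.

Let coordE k b ij : (fun t => ginibre_coord t (k, (b, ij))) =
  (if b then fun t => Num.sqrt N%:R * entry_Re (X k) ij t
   else fun t => Num.sqrt N%:R * entry_Im (X k) ij t).
Proof. by case: b. Qed.

Lemma measurable_ginibre_coord : measurable_fun [set: T] ginibre_coord.
Proof.
apply: measurable_arrayP => -[k [b ij]]; rewrite coordE.
by have [re im _] := X_ginibre k; case: b; [case: re => mf _ _|case: im => mf _ _]; exact: mf.
Qed.

Lemma gmx_ginibre_coord t : gmx (ginibre_coord t) = X ^~ t.
Proof.
have sN : Num.sqrt N%:R != 0 :> R by rewrite gt_eqF// sqrtr_gt0 ltr0n.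
apply/funext => k; apply/matrixP => i j; rewrite gmxE /ginibre_coord /=.
rewrite !mulKf//.
by apply/eqP; rewrite eq_complex /= !eqxx.
Qed.

Definition ginibre_law : probability (array R (gcoord n N)) R :=
  distribution P (mfun_Sub (mem_set measurable_ginibre_coord)).

Lemma ginibre_lawE (A : set (array R (gcoord n N))) :
  ginibre_law A = P (ginibre_coord @^-1` A).
Proof. by []. Qed.

(** Three layers of independence are peeled off in turn: between the matrices, between real and
    imaginary parts, and between the entries. [S] moves the factor [sqrt N] into the boxes, since
    the matrices are independent through their unscaled entries. *)
Lemma product_law_ginibre : product_law (@gauss R) ginibre_law.
Proof.
move=> B mB; rewrite ginibre_lawE.
pose S := (fun x : R => Num.sqrt N%:R * x).
have mS (A : set R) : measurable A -> measurable (S @^-1` A).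
  move=> mA; rewrite -[X in measurable X]setTI.
  have mS : measurable_fun [set: R] S.
    by apply: measurable_funM; [exact: measurable_cst|exact: measurable_id].
  exact: mS.
have := independent_families_box (f := fun k => entry_parts (X k))
  (B := fun k r => S @^-1` B (k, r)) (fun k r => mS _ (mB _)) X_indep.
rewrite (_ : [set t | _] = ginibre_coord @^-1` box B); last first.
  apply/seteqP; split => t /= H; first by case=> k r; exact: H.
  by move=> k r; exact: (H (k, r)).
move=> ->; transitivity (\prod_k \prod_r gauss (B (k, r)))%E; last first.
  by rewrite pair_bigA /=; apply: eq_bigr => -[].
apply: eq_bigr => k _; have [re im indep] := X_ginibre k.
have := independent_families_box
  (B := fun b ij => B (k, (b, ij))) (fun b ij => mB _) indep.
rewrite (_ : [set t | forall b j, _] =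
  [set t | forall r, (S @^-1` B (k, r)) (entry_parts (X k) r t)]); last first.
  apply/seteqP; split => t /= H; first by case=> -[] ij; [exact: (H true)|exact: (H false)].
  by case=> ij; [exact: (H (true, ij))|exact: (H (false, ij))].
move=> ->; transitivity (\prod_b \prod_ij gauss (B (k, (b, ij))))%E; last first.
  by rewrite pair_bigA /=; apply: eq_bigr => -[].
apply: eq_bigr => -[] _.
  exact: (iid_normal_box (fun ij => mB (k, (true, ij))) re).
exact: (iid_normal_box (fun ij => mB (k, (false, ij))) im).
Qed.

End ginibre_coordinates.

Section degree_two.
Context (K : comNzRingType) (n : nat) (p : ncpoly K n).
Hypothesis p_deg2 : ncdeg p = 2%N.

Definition ncoef2 i j : K := mcoeff (FMonom [:: i; j]) p.
Definition ncoef1 i : K := mcoeff (FMonom [:: i]) p.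
Definition ncoef0 : K := mcoeff (FMonom [::]) p.

Let mmeasure_p : mmeasure (@fdeg 'I_n) p = 3%N.
Proof. by move: p_deg2; rewrite /ncdeg; case: mmeasure => // m /= ->. Qed.

Lemma ncoef2_neq0 : exists i j, ncoef2 i j != 0.
Proof.
apply: contrapT => H.
suff : (mmeasure (@fdeg 'I_n) p <= 2)%N by rewrite mmeasure_p.
rewrite mmeasureE; apply/bigmax_leqP_seq => w wp _.
have := mmeasure_mnm_lt (@fdeg 'I_n) wp.
rewrite mmeasure_p ltnS leq_eqVlt => /predU1P[w2|//].
exfalso; apply: H; case: w wp w2 => -[|i [|j [|? ?]]]//= wp _.
by exists i, j; rewrite /ncoef2 mcoeff_neq0.
Qed.

(** Every coefficient, in the support or not, becomes a sum over the support, so that both sides of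
    [nceval_quadmx] can be compared word by word. *)
Let sum_word N (A : 'I_n -> 'M[K]_N) (u : fmonom 'I_n) :
  \sum_(w <- msupp p) (if w == u then mcoeff w p *: \prod_(i <- fmonom_val w) A i else 0)
  = mcoeff u p *: \prod_(i <- fmonom_val u) A i.
Proof.
have [up|up] := boolP (u \in msupp p).
  rewrite (bigD1_seq u)//= ?fset_uniq// eqxx [X in _ + X]big1 ?addr0// => w /negbTE ->.
  by [].
rewrite mcoeff_outdom// scale0r big_seq big1// => w wp.
by case: eqP up => // <-; rewrite wp.
Qed.

Lemma nceval_quadmx N (A : 'I_n -> 'M[K]_N) :
  nceval p A = \sum_i \sum_j ncoef2 i j *: (A i *m A j)
    + \sum_i ncoef1 i *: A i + ncoef0%:M.
Proof.
have F2 i j : mcoeff (FMonom [:: i; j]) p *: (A i *m A j) =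
    mcoeff (FMonom [:: i; j]) p *: \prod_(k <- fmonom_val (FMonom [:: i; j])) A k.
  by rewrite /= 2!big_cons big_nil mulr1.
have F1 i : mcoeff (FMonom [:: i]) p *: A i =
    mcoeff (FMonom [:: i]) p *: \prod_(k <- fmonom_val (FMonom [:: i])) A k.
  by rewrite /= big_cons big_nil mulr1.
have F0 : (mcoeff (FMonom [::]) p)%:M =
    mcoeff (FMonom [::]) p *: \prod_(k <- fmonom_val (FMonom [::])) A k.
  by rewrite /= big_nil scalemx1.
rewrite /ncoef2 /ncoef1 /ncoef0 F0 -sum_word.
under eq_bigr => i _ do under eq_bigr => j _ do rewrite F2 -sum_word.
under [X in _ + X + _]eq_bigr => i _ do rewrite F1 -sum_word.
under eq_bigr => i _ do rewrite exchange_big.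
rewrite exchange_big /= [X in _ + X + _]exchange_big /= -!big_split /= /nceval.
rewrite big_seq [RHS]big_seq; apply: eq_bigr => w wp.
set F := mcoeff w p *: _.
have := mmeasure_mnm_lt (@fdeg 'I_n) wp; rewrite mmeasure_p.
case: w @F wp => -[|i [|j [|? ?]]] F wp //= _.
- rewrite [X in X + _ + F]big1 ?[X in _ + X + F]big1 ?add0r// => i _.
  by rewrite big1.
- rewrite addr0 [X in X + _]big1 ?add0r; last first.
    by move=> k _; rewrite big1// => l _; case: eqP.
  rewrite (bigD1 i)//= eqxx [X in _ + X]big1 ?addr0// => k ki.
  by case: eqP => // -[ik]; rewrite ik eqxx in ki.
rewrite addr0 [X in _ + X]big1 ?addr0; last by move=> k _; case: eqP.
rewrite (bigD1 i)//= [X in _ + X]big1 ?addr0; last first.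
  move=> k ki; rewrite big1// => l _.
  by case: eqP => // -[ik]; rewrite ik eqxx in ki.
rewrite (bigD1 j)//= eqxx [X in _ + X]big1 ?addr0// => k kj.
by case: eqP => // -[jk]; rewrite jk eqxx in kj.
Qed.

End degree_two.

Lemma quadmx_subC (K : fieldType) n N (a : 'I_n -> 'I_n -> K) b c z
    (X : 'I_n -> 'M[K]_N) :
  quadmx a b c X - z%:M = quadmx a b (c - z) X.
Proof. by rewrite /quadmx -addrA raddfB. Qed.

(** * From the resolvent to the smallest singular value *)

Section smallest_singular_value_tail.
Context (R : realType) (n : nat) (a : 'I_n -> 'I_n -> R[i]) (b : 'I_n -> R[i]) (C : R).
Hypotheses (C_gt0 : 0 < C) (tail : resolvent_tail a b C).
Variables (N : nat) (mu : probability (array R (gcoord n N)) R).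
Hypotheses (N_gt0 : (0 < N)%N) (mu_gauss : product_law (@gauss R) mu).

Let bad c (eps : R) := [set w : array R (gcoord n N) |
  sigma_min (quadmx a b c (gmx w)) <= eps].

(* The relation between [e] and [eps] makes the upper bound of
   [resolvent_lower_bound] equal to [1 / 2]. *)
Lemma small_sigma_min c (eps e : R) : 0 < eps -> 0 < e -> e <= 1 ->
  4 * C * N%:R ^+ 12 * eps = e ^+ 2 ->
  small mu (bad c eps) (C * (N%:R ^+ 4 * e + expR (- N%:R)) + e).
Proof.
move=> eps0 e0 e1 eE.
have mA : mmeas (fun w : array R (gcoord n N) => quadmx a b c (gmx w)).
  by apply: mmeas_quadmx => k; exact: mmeas_gmx.
(* [resolvent_lower_bound] needs an invertible matrix but tolerates a shift of modulus up to [eps];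
   a generic shift of that size costs an extra probability [e]. *)
have [l /andP[l0 leps] sdet] := exists_generic_shift mu mA e0 eps0.
apply: small_sub (smallU (tail N_gt0 mu_gauss (c - l%:C) e0 e1) sdet).
move=> w; rewrite /bad /= => sw.
have [d0|d0] := eqVneq (\det (quadmx a b c (gmx w) - l%:C%:M)) 0; first by right.
left; rewrite -quadmx_subC; split => //; apply: contrapT => H.
have g0 : 0 <= C * N%:R ^+ 10 / e ^+ 2.
  by rewrite divr_ge0 ?mulr_ge0 ?exprn_ge0// ltW.
have := @resolvent_lower_bound R N _ l%:C eps _ N_gt0 (ltW eps0) g0 sw.
rewrite unitmxE unitfE normc_real ger0_norm ?(ltW l0)// => /(_ leps d0) K.
suff : 1 <= 2 * N%:R ^+ 2 * eps * (C * N%:R ^+ 10 / e ^+ 2).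
  rewrite (_ : _ * _ = (4 * C * N%:R ^+ 12 * eps) / (2 * e ^+ 2)); last first.
    by field; rewrite gt_eqF.
  by rewrite eE invfM mulrCA divff ?mulr1 ?expf_neq0 ?gt_eqF//; lra.
apply: K => i j; rewrite leNgt; apply/negP => h; apply: H.
by exists i, j.
Qed.

(** [e] solves the relation of [small_sigma_min], so [N^4 e] is of order [N^10 sqrt eps]. If [e]
    exceeds one, so does the right-hand side, and the bound is that of any probability. *)
Lemma sigma_min_tail c (eps : R) : 0 < eps ->
  (mu (bad c eps) <= ((C + 2 * Num.sqrt C * (C + 1)) *
    (N%:R ^+ 10 * Num.sqrt eps + expR (- N%:R)))%:E)%E.
Proof.
move=> eps0; pose e := 2 * Num.sqrt C * Num.sqrt eps * N%:R ^+ 6.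
have N1 : 1 <= N%:R :> R by rewrite ler1n.
have N0 : 0 < N%:R :> R by rewrite ltr0n.
have sC : 0 < Num.sqrt C by rewrite sqrtr_gt0.
have se : 0 < Num.sqrt eps by rewrite sqrtr_gt0.
have e0 : 0 < e by rewrite !mulr_gt0 ?exprn_gt0.
have eE : 4 * C * N%:R ^+ 12 * eps = e ^+ 2.
  rewrite /e -{1}(sqr_sqrtr (ltW C_gt0)) -{1}(sqr_sqrtr (ltW eps0)); ring.
have mE : measurable (bad c eps).
  by apply: measurable_sigma_min_le => //; apply: mmeas_quadmx => k; exact: mmeas_gmx.
have eN : e <= 2 * Num.sqrt C * (N%:R ^+ 10 * Num.sqrt eps).
  rewrite /e -mulrA ler_wpM2l ?mulr_ge0// ?(ltW sC)// mulrC ler_wpM2r ?(ltW se)//.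
  by rewrite ler_weXn2l.
have E0 := expR_ge0 (- N%:R : R).
set x := N%:R ^+ 10 * Num.sqrt eps in eN *.
have x0 : 0 < x by rewrite mulr_gt0 ?exprn_gt0.
have [e1|e1] := leP e 1.
  apply: le_trans (measurable_small mE (small_sigma_min c eps0 e0 e1 eE)) _.
  rewrite lee_fin.
  have -> : N%:R ^+ 4 * e = 2 * Num.sqrt C * x by rewrite /e /x; ring.
  have : 0 <= Num.sqrt C * (C + 1) * expR (- N%:R).
    by rewrite !mulr_ge0// ?(ltW sC)// addr_ge0 ?ltW.
  have : 0 <= C * x by rewrite mulr_ge0 ?ltW.
  move: eN; set s := Num.sqrt C; set E := expR _; lra.
apply: le_trans (probability_le1 mu mE) _; rewrite lee_fin.
apply: le_trans (ltW e1) _; apply: le_trans eN _.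
have : 0 <= Num.sqrt C * C * x by rewrite !mulr_ge0 ?ltW.
have : 0 <= C * x by rewrite mulr_ge0 ?ltW.
have : 0 <= (C + 2 * Num.sqrt C * (C + 1)) * expR (- N%:R).
  by rewrite mulr_ge0// addr_ge0 ?mulr_ge0 ?addr_ge0 ?ltW.
lra.
Qed.

End smallest_singular_value_tail.

Local Close Scope complex_scope.

Theorem theorem1p3 (R : realType) :
  exists C0 : R, 0 < C0 /\
  forall (n : nat) (p : ncpoly R[i] n), ncdeg p = 2%N ->
  exists C c : R, 0 < C /\ 0 < c /\
  forall (N : nat), (0 < N)%N ->
  forall (d : measure_display) (T : measurableType d) (P : probability T R)
    (X : 'I_n -> T -> 'M[R[i]]_N),
    (forall k, complex_ginibre P (X k)) -> independent_matrices P X ->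
  forall (z : R[i]) (eps : R), 0 < eps ->
    (P [set t | (sigma_min (nceval p (fun k => X k t) - z%:M) <= eps)%R]
       <= (C * (N%:R `^ C0 * eps `^ c + expR (- N%:R)))%:E)%E.
Proof.
exists 10; split => // n p p2.
have [i0 [m0 a0]] := ncoef2_neq0 p2.
have [C C0 tail] := quadratic_resolvent_tail (ncoef1 p) a0.
exists (C + 2 * Num.sqrt C * (C + 1)), (1 / 2); split.
  by rewrite addr_gt0 ?mulr_gt0 ?sqrtr_gt0 ?addr_gt0.
split => // N N0 d T P X XG XI z eps eps0.
have := sigma_min_tail C0 tail N0 (product_law_ginibre XG XI) (ncoef0 p - z) eps0.
have -> : N%:R ^+ 10 * Num.sqrt eps = N%:R `^ 10 * eps `^ (1 / 2).
  by rewrite powR_mulrn ?ler0n// div1r powR12_sqrt// ltW.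
pose S := [set w : array R (gcoord n N) |
  sigma_min (quadmx (ncoef2 p) (ncoef1 p) (ncoef0 p - z) (gmx w)) <= eps].
rewrite -/S (ginibre_lawE XG S).
have evalE t : nceval p (fun k => X k t) - z%:M =
    quadmx (ncoef2 p) (ncoef1 p) (ncoef0 p - z) (gmx (ginibre_coord X t)).
  by rewrite (gmx_ginibre_coord N0) -quadmx_subC nceval_quadmx.
have -> : [set t | sigma_min (nceval p (fun k => X k t) - z%:M) <= eps] =
    @ginibre_coord R d T n N X @^-1` S.
  exact: (eq_set (fun t => congr1 (fun M => is_true (sigma_min M <= eps)) (evalE t))).
by [].
Qed.
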